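(* Let $n\ge 2$ and let $f:\mathbb S^n\to\mathbb C$ be such that $f\in C^1(\mathbb S^n)$, $|f|\in C^1(\mathbb S^n)$ and $\int_{\mathbb S^n}|f(x)|^2d\sigma(x)=1$. Then $$\mathrm V_{x,f}\,\mathrm V^*_{\nabla_{\mathbb S^n},f}\;\geq\;\frac{n^2}{4}|\tau_f|^4+\mathrm{COV}_*^2 .$$
   Context: $\mathbb S^n=\{x=(x_0,\dots,x_n)^T\in\mathbb R^{n+1}:|x|=1\}$ with normalized surface measure $\sigma$. Spherical gradient: for a $C^1$ function $f$ on $\mathbb S^n$, $\nabla_{\mathbb S^n}f=(\Gamma_0f,\dots,\Gamma_nf)^T$ is defined by $\nabla_{\mathbb S^n}f(x)=\nabla F(x)$ for $x\in\mathbb S^n$, where $F(y)=f(y/|y|)$ on $\mathbb R^{n+1}\setminus\{0\}$ and $\nabla$ is the Euclidean gradient in $\mathbb R^{n+1}$. (So $x\cdot\nabla_{\mathbb S^n}f(x)=0$.) Norms of vectors in $\mathbb C^{n+1}$ are Hermitian norms. Phase derivative of $f=u+iv$ on $\mathbb S^n$: at points where $f(x)\ne0$, $$\Phi_f'(x)=\frac{\nabla_{\mathbb S^n} f(x)}{2if(x)}-\frac{\nabla_{\mathbb S^n} \overline{f(x)}}{2i\,\overline{f(x)}}=\frac{u\nabla_{\mathbb S^n}v-v\nabla_{\mathbb S^n}u}{|f|^2}(x).$$ Integrands containing the product of a positive power of $|f(x)|$ with an expression in $\Phi_f'(x)$ are taken to be $0$ where $f(x)=0$. Definitions, for $f$ with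 $\int_{\mathbb S^n}|f|^2d\sigma=1$: - $\tau_f=\int_{\mathbb S^n}x|f(x)|^2d\sigma(x)\in\mathbb R^{n+1}$; - $\mathrm V_{x,f}=\int_{\mathbb S^n}|x-\tau_f|^2|f(x)|^2d\sigma(x)=1-|\tau_f|^2$; - $a^*(f)=\mathrm{Im}\left\{\int_{\mathbb S^n}[\nabla_{\mathbb S^n}f(x)]\,\overline{f(x)}\,d\sigma(x)\right\}\in\mathbb R^{n+1}$ (componentwise imaginary part); - $\mathrm V^*_{\nabla_{\mathbb S^n},f}=\int_{\mathbb S^n}|-i\nabla_{\mathbb S^n}f(x)-a^*(f)f(x)|^2d\sigma(x)$; - $\mathrm{COV}_*=\int_{\mathbb S^n}|x-\tau_f|\,|\Phi_f'(x)-a^*(f)|\,|f(x)|^2d\sigma(x)$. *)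

(* Defs.v *)
From HB Require Import structures.
From mathcomp Require Import all_boot all_order all_algebra.
From mathcomp Require Import all_classical all_reals all_analysis.
From mathcomp Require Import measurable_realfun complex ring.

Set Implicit Arguments.
Unset Strict Implicit.
Unset Printing Implicit Defensive.

Import Order.TTheory GRing.Theory Num.Theory.
Import numFieldNormedType.Exports ComplexField.Normc.

Local Open Scope classical_set_scope.
Local Open Scope ring_scope.

(* Row vectors carry the product sigma-algebra, generated by the coordinate
   maps; on 'rV[R]_n it is the Borel sigma-algebra of R^n. *)
Section measurable_rV.
Context {d} {T : sigmaRingType d}.
Variable n : nat.

Let coors : 'I_n -> 'rV[T]_n -> T := fun i x => x ord0 i.

Let rV_set0 : g_sigma_preimage coors set0.
Proof. exact: sigma_algebra0. Qed.

Let rV_setC A : g_sigma_preimage coors A -> g_sigma_preimage coors (~` A).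
Proof. exact: sigma_algebraC. Qed.

Let rV_bigcup (F : _^nat) : (forall i, g_sigma_preimage coors (F i)) ->
  g_sigma_preimage coors (\bigcup_i (F i)).
Proof. exact: sigma_algebra_bigcup. Qed.

HB.instance Definition _ := @isMeasurable.Build (measure_tuple_display d)
  'rV[T]_n (g_sigma_preimage coors) rV_set0 rV_setC rV_bigcup.

End measurable_rV.

Lemma measurable_coord_rV d (T : sigmaRingType d) n (i : 'I_n) :
  measurable_fun [set: 'rV[T]_n] (fun x => x ord0 i).
Proof.
move=> _ Y mY; rewrite setTI; apply: sub_sigma_algebra => /=.
rewrite -bigcup_seq/=; exists i => /=; first by rewrite mem_index_enum.
by exists Y => //; rewrite setTI.
Qed.

Lemma measurable_fun_rV d1 d2 (T1 : measurableType d1) (T2 : measurableType d2)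
    n (f : T1 -> 'rV[T2]_n) :
  (forall i, measurable_fun [set: T1] (fun x => f x ord0 i)) ->
  measurable_fun [set: T1] f.
Proof.
move=> mf.
have H : g_sigma_preimage (fun i x => f x ord0 i) `<=` measurable.
  apply: smallest_sub; first exact: sigma_algebra_measurable.
  case: n => [|n] in f mf *; first by rewrite big_ord0.
  rewrite -bigcup_mkord_ord; apply: bigcup_sub => i Ii.
  by move=> A [B mB <-]; exact: mf.
move=> _ A mA; apply: H.
pose coor := fun (i : 'I_n) (x : 'rV[T2]_n) => x ord0 i.
have -> : g_sigma_preimage (fun i x => f x ord0 i) =
    g_sigma_preimage (fun i => coor i \o f) by [].
by rewrite g_sigma_preimage_comp; exists A.
Qed.

Section lebesgue_rV.
Variable R : realType.
Local Open Scope ereal_scope.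

Definition cons_rV n (p : 'rV[R]_n * R) : 'rV[R]_n.+1 :=
  \row_(i < n.+1) (if unlift ord0 i is Some j then p.1 ord0 j else p.2).

Lemma cons_rV0 n (p : 'rV[R]_n * R) : cons_rV p ord0 ord0 = p.2.
Proof. by rewrite mxE unlift_none. Qed.

Lemma cons_rVS n (p : 'rV[R]_n * R) i : cons_rV p ord0 (lift ord0 i) = p.1 ord0 i.
Proof. by rewrite mxE liftK. Qed.

Lemma measurable_cons_rV n : measurable_fun setT (@cons_rV n).
Proof.
apply: measurable_fun_rV => i.
have [->|[j ->]] : i = ord0 \/ exists j, i = lift ord0 j.
  by case: (unliftP ord0 i) => [j|] ->; [right; exists j|left].
- by apply: (eq_measurable_fun snd) => // p _; rewrite cons_rV0.
- apply: (eq_measurable_fun ((fun x : 'rV[R]_n => x ord0 j) \o fst)) => [p _|].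
    by rewrite cons_rVS.
  by apply: measurableT_comp => //; exact: measurable_coord_rV.
Qed.

Definition lebesgue_step n (m : {measure set 'rV[R]_n -> \bar R}) :
    set 'rV[R]_n.+1 -> \bar R :=
  pushforward (m \x lebesgue_measure) (@cons_rV n).

Section lebesgue_step_measure.
Variables (n : nat) (m : {measure set 'rV[R]_n -> \bar R}).
Let mcons := @measurable_cons_rV n.
Let step0 : lebesgue_step m set0 = 0.
Proof. by rewrite /lebesgue_step measure0. Qed.
Let step_ge0 A : 0 <= lebesgue_step m A.
Proof. exact: measure_ge0. Qed.
Let step_sigma : semi_sigma_additive (lebesgue_step m).
Proof. exact: measure_semi_sigma_additive. Qed.
HB.instance Definition _ :=
  isMeasure.Build _ _ _ (lebesgue_step m) step0 step_ge0 step_sigma.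
End lebesgue_step_measure.

(* Lebesgue measure on R^n, as the n-fold product of lebesgue_measure. *)
Fixpoint lebesgue_rV (n : nat) : {measure set 'rV[R]_n -> \bar R} :=
  if n is n'.+1 then lebesgue_step (lebesgue_rV n')
  else dirac (0%R : 'rV[R]_0).

End lebesgue_rV.

Section euclidean.
Variable R : realType.

(* The norm `|x| of the library on 'rV[R]_n is the sup norm. *)
Definition enorm n (x : 'rV[R]_n) : R := Num.sqrt (\sum_i x ord0 i ^+ 2).

Definition hnorm n (z : 'rV[R[i]]_n) : R :=
  Num.sqrt (\sum_i normc (z ord0 i) ^+ 2).

Definition sphere n : set 'rV[R]_n.+1 := [set x | enorm x = 1].

Definition unit_ball n : set 'rV[R]_n := [set x | enorm x <= 1].

Definition unit_vec n (x : 'rV[R]_n) : 'rV[R]_n := (enorm x)^-1 *: x.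

Arguments sphere : clear implicits.
Arguments unit_ball : clear implicits.

Lemma measurable_enorm n : measurable_fun setT (@enorm n).
Proof.
apply: (@measurableT_comp _ _ _ _ _ _ (@Num.sqrt R)).
  by apply: continuous_measurable_fun; exact: sqrt_continuous.
apply: measurable_sum => i; apply: measurable_funX.
exact: measurable_coord_rV.
Qed.

Lemma measurable_unit_ball n : measurable (unit_ball n).
Proof.
rewrite (_ : unit_ball _ = setT `&` @enorm n @^-1` `]-oo, 1]).
  by apply: measurable_enorm.
by apply/seteqP; split => x; rewrite /unit_ball /= in_itv /= => // -[].
Qed.

Lemma measurable_invr : measurable_fun setT (@GRing.inv R).
Proof.
rewrite -(setvU [set 0]); apply/measurable_funU => //.
  exact: measurableC.
split; last exact: measurable_fun_set1.
apply: open_continuous_measurable_fun.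
  exact/closed_openC/closed_eq.
by move=> x; rewrite inE /= => /eqP x0; exact: inv_continuous.
Qed.

Lemma measurable_unit_vec n : measurable_fun setT (@unit_vec n).
Proof.
apply: measurable_fun_rV => i.
apply: (eq_measurable_fun (fun x => (enorm x)^-1 * x ord0 i)) => [x _|].
  by rewrite mxE.
apply: measurable_funM; last exact: measurable_coord_rV.
apply: (@measurableT_comp _ _ _ _ _ _ (@GRing.inv R)) => //.
  exact: measurable_invr.
exact: measurable_enorm.
Qed.

Lemma measurable_box n (a b : R) :
  measurable [set x : 'rV[R]_n | forall i, a <= x ord0 i <= b].
Proof.
rewrite (_ : mkset _ = \bigcap_(i in [set: 'I_n])
    (setT `&` (fun x : 'rV[R]_n => x ord0 i) @^-1` `[a, b])).
  apply: fin_bigcap_measurable => // i _.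
  exact: measurable_coord_rV.
apply/seteqP; split => x /= h i.
  by move=> _; split => //=; rewrite in_itv /=.
by have [] := h i Logic.I => _; rewrite /= in_itv.
Qed.

Lemma lebesgue_rV_box n (a b : R) : a <= b ->
  lebesgue_rV R n [set x | forall i, a <= x ord0 i <= b] = ((b - a) ^+ n)%:E.
Proof.
move=> ab; elim: n => [|n IH].
  by rewrite /= diracE mem_set ?expr0// => -[].
rewrite /= /lebesgue_step /pushforward.
rewrite (_ : _ @^-1` _ =
   [set x : 'rV[R]_n | forall i, a <= x ord0 i <= b] `*` `[a, b]%classic).
  rewrite product_measure1E//; last exact: measurable_box.
  have ab1 : lebesgue_measure `[a, b]%classic = (b - a)%:E.
    by rewrite lebesgue_measure_itv /= lte_fin; case: ltgtP ab => // ->; rewrite subrr.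
  by rewrite exprSr EFinM; congr (_ * _)%E.
apply/seteqP; split => -[x t] /=.
  move=> h; split; last by have := h ord0; rewrite cons_rV0 in_itv.
  by move=> i; have := h (lift ord0 i); rewrite cons_rVS.
rewrite in_itv /= => -[h ht] i.
by case: (unliftP ord0 i) => [j|] ->; rewrite ?cons_rVS ?cons_rV0.
Qed.

Definition ball_volume n : R := fine (lebesgue_rV R n (unit_ball n)).

Lemma lebesgue_rV_ball_fin n : lebesgue_rV R n (unit_ball n) = (ball_volume n)%:E.
Proof.
rewrite /ball_volume fineK// ge0_fin_numE//.
apply: (@le_lt_trans _ _ (lebesgue_rV R n [set x | forall i, -1 <= x ord0 i <= 1])).
  apply: le_measure; rewrite ?inE; first exact: measurable_unit_ball.
    exact: measurable_box.
  move=> x /= x1 i; rewrite -ler_norml -sqrtr_sqr (le_trans _ x1)//.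
  rewrite ler_sqrt ?sumr_ge0// => [|j _]; last exact: sqr_ge0.
  by rewrite (bigD1 i)//= lerDl sumr_ge0// => j _; exact: sqr_ge0.
by rewrite lebesgue_rV_box ?ltry// lerN10.
Qed.

Lemma ball_volume_gt0 n : 0 < ball_volume n.
Proof.
rewrite -lte_fin -lebesgue_rV_ball_fin.
pose c : R := n.+1%:R^-1.
have c0 : 0 < c by rewrite invr_gt0.
apply: (@lt_le_trans _ _ (lebesgue_rV R n [set x | forall i, 0 <= x ord0 i <= c])).
  by rewrite lebesgue_rV_box ?lte_fin ?subr0 ?exprn_gt0 ?ltW.
apply: le_measure; rewrite ?inE; first exact: measurable_box.
  exact: measurable_unit_ball.
move=> x /= xc; rewrite /unit_ball /= -sqrtr1 ler_sqrt//.
apply: (@le_trans _ _ (\sum_(i < n) c)).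
  apply: ler_sum => i _; have /andP[x0 xic] := xc i.
  rewrite (le_trans _ xic)// expr2 ler_piMl// (le_trans xic)//.
  by rewrite invf_le1// ler1n.
rewrite sumr_const card_ord -mulr_natl ler_pdivrMr ?mul1r// ler_nat.
exact: leqnSn.
Qed.

(* Normalized surface measure: the measure of A `<=` S^n is the fraction of
   the volume of the unit ball of R^(n+1) taken by the cone over A. *)
Definition sphere_measure n (A : set 'rV[R]_n.+1) : \bar R :=
  ((ball_volume n.+1)^-1%:E *
   lebesgue_rV R n.+1 (@unit_vec n.+1 @^-1` A `&` unit_ball n.+1))%E.

Arguments sphere_measure : clear implicits.

Section sphere_measure_is_probability.
Variable n : nat.
Local Open Scope ereal_scope.

Let sphere_measure0 : sphere_measure n set0 = 0 :> \bar R.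
Proof. by rewrite /sphere_measure preimage_set0 set0I measure0 mule0. Qed.

Let sphere_measure_ge0 (A : set 'rV[R]_n.+1) : 0 <= sphere_measure n A.
Proof. by rewrite mule_ge0// lee_fin invr_ge0 ltW// ball_volume_gt0. Qed.

Let sphere_measure_sigma : semi_sigma_additive (sphere_measure n).
Proof.
move=> F mF tF mU.
have m1 := @measurable_unit_vec n.+1.
have mB := @measurable_unit_ball n.+1.
have c0 : (0 <= (ball_volume n.+1)^-1)%R by rewrite invr_ge0 ltW// ball_volume_gt0.
pose mu1 : {measure set 'rV[R]_n.+1 -> \bar R} := mrestr (lebesgue_rV R n.+1) mB.
pose mu2 : {measure set 'rV[R]_n.+1 -> \bar R} := pushforward mu1 (@unit_vec n.+1).
exact: (@measure_semi_sigma_additive _ _ _ (mscale (NngNum c0) (mu2 m1)) F mF tF mU).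
Qed.

HB.instance Definition _ := isMeasure.Build _ _ _ (sphere_measure n)
  sphere_measure0 sphere_measure_ge0 sphere_measure_sigma.

Let sphere_measure_setT : sphere_measure n [set: 'rV[R]_n.+1] = 1.
Proof.
rewrite /sphere_measure preimage_setT setTI lebesgue_rV_ball_fin -EFinM mulVf//.
by rewrite gt_eqF// ball_volume_gt0.
Qed.

HB.instance Definition _ := Measure_isProbability.Build _ _ _
  (sphere_measure n) sphere_measure_setT.

End sphere_measure_is_probability.

Definition radial_ext (T : Type) n (g : 'rV[R]_n.+1 -> T) : 'rV[R]_n.+1 -> T :=
  fun y => g (unit_vec y).

(* Functions on S^n are functions on R^(n+1) of which only the values on S^n
   matter: regularity and gradients go through radial_ext, and integrals range
   over sphere n. *)
Definition C1_sphere n (g : 'rV[R]_n.+1 -> R) : Prop :=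
  forall (x : 'rV[R]_n.+1) (i : 'I_n.+1), x != 0 ->
    derivable (radial_ext g) x (delta_mx ord0 i) /\
    {for x, continuous ('D_(delta_mx ord0 i) (radial_ext g))}.

Definition C1_sphereC n (f : 'rV[R]_n.+1 -> R[i]) : Prop :=
  C1_sphere (fun x => complex.Re (f x)) /\
  C1_sphere (fun x => complex.Im (f x)).

Definition sgrad n (g : 'rV[R]_n.+1 -> R) (x : 'rV[R]_n.+1) : 'rV[R]_n.+1 :=
  \row_i 'D_(delta_mx ord0 i) (radial_ext g) x.

Definition sgradC n (f : 'rV[R]_n.+1 -> R[i]) (x : 'rV[R]_n.+1) :
    'rV[R[i]]_n.+1 :=
  \row_i (sgrad (fun y => complex.Re (f y)) x ord0 i +i*
          sgrad (fun y => complex.Im (f y)) x ord0 i)%C.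

Definition sint n (g : 'rV[R]_n.+1 -> R) : R :=
  \int[sphere_measure n]_(x in sphere n) g x.

Definition sintC n (g : 'rV[R]_n.+1 -> R[i]) : R[i] :=
  (sint (fun x => complex.Re (g x)) +i* sint (fun x => complex.Im (g x)))%C.

Definition rowC n (x : 'rV[R]_n) : 'rV[R[i]]_n := map_mx (fun r : R => r%:C%C) x.

Section uncertainty.
Variables (n : nat) (f : 'rV[R]_n.+1 -> R[i]).

(* At the zeros of f the value is 0, since x / 0 = 0. *)
Definition phase_deriv (x : 'rV[R]_n.+1) : 'rV[R]_n.+1 :=
  let u := fun y => complex.Re (f y) in
  let v := fun y => complex.Im (f y) in
  (normc (f x) ^+ 2)^-1 *: (u x *: sgrad v x - v x *: sgrad u x).

Definition tau : 'rV[R]_n.+1 :=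
  \row_i sint (fun x => x ord0 i * normc (f x) ^+ 2).

Definition Vx : R := sint (fun x => enorm (x - tau) ^+ 2 * normc (f x) ^+ 2).

Definition astar : 'rV[R]_n.+1 :=
  \row_i complex.Im (sintC (fun x => sgradC f x ord0 i * ((f x)^*)%C)).

Definition Vgrad_star : R :=
  sint (fun x => hnorm ((- 'i%C) *: sgradC f x - f x *: rowC astar) ^+ 2).

Definition COV_star : R :=
  sint (fun x => enorm (x - tau) * enorm (phase_deriv x - astar) *
                 normc (f x) ^+ 2).

End uncertainty.

Lemma sgradN n (g : 'rV[R]_n.+1 -> R) (x : 'rV[R]_n.+1) :
  (forall i, derivable (radial_ext g) x (delta_mx ord0 i)) ->
  sgrad (fun y => - g y) x = - sgrad g x.
Proof.
move=> dg; apply/rowP => i; rewrite !mxE.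
by rewrite (_ : radial_ext _ = - radial_ext g)// deriveN.
Qed.

Lemma phase_derivE n (f : 'rV[R]_n.+1 -> R[i]) (x : 'rV[R]_n.+1) :
  C1_sphereC f -> x != 0 -> f x != 0 ->
  rowC (phase_deriv f x) =
  (2 * 'i%C * f x)^-1 *: sgradC f x -
  (2 * 'i%C * ((f x)^*)%C)^-1 *: sgradC (fun y => ((f y)^*)%C) x.
Proof.
move=> [Cu Cv] x0 fx0.
have fxc0 : ((f x)^*)%C != 0 by rewrite conjc_eq0.
have i0 : 'i%C != 0 :> R[i].
  by rewrite eq_complex /= negb_and oner_neq0 orbT.
have ti0 : 2 * 'i%C != 0 :> R[i] by rewrite mulf_neq0// pnatr_eq0.
have n0 : (normc (f x) ^+ 2)%:C%C = f x * ((f x)^*)%C :> R[i].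
  by rewrite -sqr_normc rmorphXn.
have -> : sgradC (fun y => ((f y)^*)%C) x = map_mx conjc (sgradC f x).
  apply/rowP => i; rewrite [LHS]mxE [RHS]mxE [X in conjc X]mxE /=.
  congr (_ +i* _)%C.
    by congr (sgrad _ x _ _); apply/funext => y; case: (f y).
  rewrite (_ : (fun y => complex.Im (f y)^*%C) = fun y => - complex.Im (f y)).
    by rewrite sgradN ?mxE// => j; have [] := Cv x j x0.
  by apply/funext => y; case: (f y).
apply/rowP => i.
have E1 : sgradC f x ord0 i = (sgrad (fun y => complex.Re (f y)) x ord0 i +i*
    sgrad (fun y => complex.Im (f y)) x ord0 i)%C by rewrite mxE.
rewrite [LHS]mxE [RHS]mxE [X in X + _]mxE [X in _ + X]mxE [X in - X]mxE [X in _ - _ * X]mxE E1.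
rewrite [phase_deriv _ _ _ _]mxE [X in _ * X]mxE [X in X + _]mxE [X in _ + X]mxE [X in - X]mxE.
move: (sgrad _ _ _ _) (sgrad _ _ _ _) => p q.
have kE : (q +i* p)%C * ((f x)^*)%C - ((q +i* p)^*)%C * f x =
    2 * 'i%C * (complex.Re (f x) * p - complex.Im (f x) * q)%:C%C.
  case: (f x) => a b; apply/eqP; rewrite eq_complex; apply/andP.
  by split; apply/eqP => /=; ring.
have lE (D : R) : (normc (f x) ^- 2 * D)%:C%C =
    (f x * ((f x)^*)%C)^-1 * D%:C%C :> R[i].
  by rewrite -n0 -fmorphV -rmorphM.
rewrite lE; apply: (mulfI ti0); rewrite mulrCA -kE; field.
by rewrite i0 fx0 fxc0.
Qed.

End euclidean.

Arguments sphere : clear implicits.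
Arguments unit_ball : clear implicits.
Arguments ball_volume : clear implicits.
Arguments sphere_measure : clear implicits.

(* Main.v *)
Require Import Defs.
From HB Require Import structures.
From mathcomp Require Import all_boot all_order all_algebra.
From mathcomp Require Import all_classical all_reals all_analysis.
From mathcomp Require Import measurable_realfun complex ring lra.
Set Implicit Arguments.
Unset Strict Implicit.
Unset Printing Implicit Defensive.
Import Order.TTheory GRing.Theory Num.Theory.
Import numFieldNormedType.Exports ComplexField.Normc.
Local Open Scope classical_set_scope.
Local Open Scope ring_scope.

(** Write [f = u + i v] and [rho = u^2 + v^2]; [X = x - tau f] and
    [a = astar f].  At a point of the sphere where [f] does not vanish, put
    [b = (u grad u + v grad v) / |f|] and [c = |f| (Phi' - a)], with [Phi'] the
    phase derivative.  Multiplying [grad f] by the unit number [conj f / |f|] separates its real and imaginary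
    parts and gives
    [|- i grad f - a f|^2 = |b|^2 + |c|^2].
    The first term is paired with [rho] through [|f| b = grad rho / 2], the
    second with the covariance, and both are compared with [|X|^2 rho]: for
    all reals [al], [be], [ga],
    [0 <= |ga b + al |f| X|^2 + (ga |c| + be |f| |X|)^2]
    is a quadratic form whose coefficients are the integrands of
    [Vgrad_star], [COV_star], [Vx] and [X . grad rho / 2]
    ([pointwise_quadratic]).  Integrating it and choosing the best
    coefficients ([quadratic_bound]) yields
    [Vx * Vgrad_star >= (sint (X . grad rho / 2))^2 + COV_star^2],
    two Cauchy-Schwarz inequalities at once.  Phrased with [u grad u + v grad v]
    instead of [b], the integrands are continuous, also at the zeros of [f].

    It remains to see that [sint (X . grad rho / 2) = - n / 2 * |tau|^2].  Since
    [x . grad rho = 0], this follows from the divergence theorem on the sphere,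
    [sint (grad rho) = n sint (x rho)] ([sphere_divergence]).

    The normalized surface measure is a cone measure, so the divergence theorem
    amounts to the vanishing of the integral of
    [K (y / |y|)] over the unit ball, where [K x = grad_i g x - n x_i g x].
    With [G] the extension of [g] that is homogeneous of degree 0, one has
    [|y| K (y / |y|) = |y|^2 D_i G y - n y_i G y], and by Euler's relation
    [y . grad G = 0] this is the divergence of the vector field
    [j |-> (delta_ij |y|^2 - y_i y_j) G y].  That field is tangent to the
    spheres centred at the origin, so it can be multiplied by any function
    [w (|y|^2)] without a further term in the divergence.  If [w] has compact
    support in the positive reals, Fubini and the fundamental theorem of
    calculus show that the integral over the whole space vanishes
    ([integral_tangential]); letting [w s] tend to [1 / sqrt s] for
    [0 < s <= 1] and to [0] elsewhere leaves the integral of [K (y / |y|)] over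
    the ball. *)

(** * Borel sets and Fubini on row vectors *)

Section measurability.
Variable R : realType.

Lemma measurable_open_box n (a b : 'rV[R]_n) :
  measurable [set x : 'rV[R]_n | forall i, a ord0 i < x ord0 i < b ord0 i].
Proof.
rewrite (_ : mkset _ = \bigcap_(i in [set: 'I_n])
    (setT `&` (fun x : 'rV[R]_n => x ord0 i) @^-1` `]a ord0 i, b ord0 i[)).
  by apply: fin_bigcap_measurable => // i _; exact: measurable_coord_rV.
apply/seteqP; split => x /= h i; first by split => //=; rewrite in_itv /=.
by have [] := h i Logic.I => _; rewrite /= in_itv.
Qed.

(** An open set is the union of the boxes with rational corners that it
    contains, and these are countably many. *)
Lemma open_measurable_rV n (U : set 'rV[R]_n) : open U -> measurable U.
Proof.
move=> oU.
pose box (ab : 'rV[rat]_n * 'rV[rat]_n) := [set x : 'rV[R]_n |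
  forall i, map_mx (@ratr R) ab.1 ord0 i < x ord0 i
            < map_mx (@ratr R) ab.2 ord0 i].
pose F ab := if `[< box ab `<=` U >] then box ab else set0.
rewrite (_ : U = \bigcup_ab F ab).
  apply: countable_bigcupT_measurable => [|ab]; first exact: countableP.
  by rewrite /F; case: ifP => _ //; exact: measurable_open_box.
apply/seteqP; split => [x Ux|x [ab _]]; last first.
  by rewrite /F; case: ifPn => // /asboolP; apply.
have [e /= e0 xeU] := (@nbhs_ballP _ _ x U).1 (open_nbhs_nbhs (conj oU Ux)).
have /choice[a ha] : forall i, exists q : rat,
    x ord0 i - e < ratr q < x ord0 i.
  move=> i; have /rat_in_itvoo[q] : x ord0 i - e < x ord0 i by rewrite gtrBl.
  by rewrite in_itv; exists q.
have /choice[b hb] : forall i, exists q : rat,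
    x ord0 i < ratr q < x ord0 i + e.
  move=> i; have /rat_in_itvoo[q] : x ord0 i < x ord0 i + e by rewrite ltrDl.
  by rewrite in_itv; exists q.
exists (\row_i a i, \row_i b i) => //; rewrite /F ifT.
  by move=> i /=; rewrite !mxE; have /andP[_ ->] := ha i; have /andP[-> _] := hb i.
apply/asboolP => y /= yab; apply: xeU; split => // i j; rewrite ord1.
have /= := yab j; rewrite !mxE => /andP[ay yb].
have /andP[xa _] := ha j; have /andP[_ bx] := hb j.
rewrite /ball /= ltr_norml; apply/andP; split; lra.
Qed.

Lemma continuous_measurable_rV n (D : set 'rV[R]_n) (f : 'rV[R]_n -> R) :
  open D -> (forall x, D x -> {for x, continuous f}) -> measurable_fun D f.
Proof.
move=> oD fc; apply: (measurability _ (RGenOpens.measurableE R)).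
move=> _ [_ [a [b ->] <-]]; apply: open_measurable_rV.
rewrite openE => x [Dx fx]; apply: filterI; first exact: open_nbhs_nbhs.
by apply: (fc x Dx); apply: open_nbhs_nbhs; split => //; exact: interval_open.
Qed.

End measurability.

Section product_integral.
Variable R : realType.

Lemma lebesgue_rV_sigma_finite n : sigma_finite setT (lebesgue_rV R n).
Proof.
exists (fun k => [set x : 'rV[R]_n | forall i, - k%:R <= x ord0 i <= k%:R]).
  apply/esym/seteqP; split => // x _.
  exists (Num.bound (\sum_i `|x ord0 i|)) => //= i.
  rewrite -ler_norml (le_trans _ (ltW (archi_boundP _)))//.
    by rewrite (bigD1 i)//= lerDl sumr_ge0.
  by rewrite sumr_ge0.
move=> k; split; first exact: measurable_box.
by rewrite lebesgue_rV_box ?ltry// ge0_cp.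
Qed.

(** A copy of [lebesgue_rV] under a name to which the sigma-finite structure
    required by Fubini can be attached. *)
Definition lebesgue_rV_sf n : set 'rV[R]_n -> \bar R := lebesgue_rV R n.
HB.instance Definition _ n := Measure.copy (@lebesgue_rV_sf n) (lebesgue_rV R n : set _ -> \bar R).
HB.instance Definition _ n := Measure_isSigmaFinite.Build _ _ _ (@lebesgue_rV_sf n)
  (@lebesgue_rV_sigma_finite n).

Lemma bounded_box_integrable n (h : 'rV[R]_n -> R) (M C : R) :
  measurable_fun setT h -> (forall x, `|h x| <= C) ->
  (forall x : 'rV_n, ~ (forall i, - M <= x ord0 i <= M) -> h x = 0) ->
  (lebesgue_rV R n).-integrable setT (EFin \o h).
Proof.
move=> mh hC h0.
pose B := [set x : 'rV[R]_n | forall i, - M <= x ord0 i <= M].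
have mB : measurable B by exact: measurable_box.
suff : (lebesgue_rV R n).-integrable B (EFin \o h).
  move=> /(integrable_mkcond _ mB); congr (_.-integrable _ _).
  apply/funext => x; rewrite patchE; case: ifPn => // /negP xB.
  by rewrite /= h0// => xB'; apply: xB; rewrite inE.
apply: measurable_bounded_integrable => //.
- rewrite /B; have [M0|M0] := leP 0 M.
    by rewrite lebesgue_rV_box ?ltry// ge0_cp.
  case: n h mh hC h0 @B mB => [|n] h mh hC h0 B mB.
    by rewrite /= diracE; case: (_ \in _); rewrite ltry.
  rewrite (_ : [set x | _] = set0) ?measure0//.
  apply/seteqP; split => // x /= /(_ ord0) /andP[/le_trans h1 /h1].
  by rewrite leNgt (lt_trans M0)// oppr_gt0.
- exact: measurable_funTS.
- exists C; split; first exact: num_real.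
  by move=> y Cy x _ /=; rewrite (le_trans (hC x))// ltW.
Qed.

Lemma integrable_cons_rV n (h : 'rV[R]_n.+1 -> R) :
  (lebesgue_rV R n.+1).-integrable setT (EFin \o h) ->
  (@lebesgue_rV_sf n \x lebesgue_measure)%E.-integrable setT (EFin \o h \o @cons_rV R n).
Proof.
move=> /integrableP[mh hoo]; apply/integrableP; split.
  by apply: measurableT_comp => //; exact: measurable_cons_rV.
rewrite (le_lt_trans _ hoo)// [leRHS]ge0_integral_pushforward ?preimage_setT//.
- exact: measurable_cons_rV.
- exact: measurableT_comp.
Qed.

Lemma integral_cons_rV n (h : 'rV[R]_n.+1 -> R) :
  (lebesgue_rV R n.+1).-integrable setT (EFin \o h) ->
  (\int[lebesgue_rV R n.+1]_x (h x)%:E =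
   \int[@lebesgue_rV_sf n \x lebesgue_measure]_z (h (cons_rV z))%:E)%E.
Proof.
move=> ih; rewrite [LHS]integral_pushforward ?preimage_setT//.
- exact: measurable_cons_rV.
- exact: (measurable_int _ ih).
- exact: integrable_cons_rV.
Qed.

(** The boundary terms of the fundamental theorem of calculus vanish on an
    interval slightly larger than the support. *)
Lemma integral_derivative_compact0 (F f : R -> R) (M : R) :
  (forall t : R, is_derive t 1 F (f t)) -> continuous f ->
  (forall t, ~ (- M <= t <= M) -> F t = 0) ->
  (\int[lebesgue_measure]_t (f t)%:E = 0)%E.
Proof.
move=> dF cf F0.
have f0 t : ~ (- M <= t <= M) -> f t = 0.
  move=> tM; have [_ <-] := dF t.
  rewrite (@near_eq_derive _ _ _ F (cst 0)) ?derive_cst//.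
  have [tN|tN] := ltP t (- M).
    near=> s; rewrite F0// => /andP[+ _]; rewrite leNgt => /negP; apply.
    by near: s; exact: lt_nbhsl.
  have {}tN : M < t by rewrite ltNge; apply/negP => tM'; apply: tM; rewrite tN.
  near=> s; rewrite F0// => /andP[_]; rewrite leNgt => /negP; apply.
  by near: s; exact: lt_nbhsr.
pose a := `|M| + 1.
have aM : M < a by rewrite /a ltr_pwDr// ler_norm.
have a0 : - a < a by rewrite /a gtrN// ltr_wpDl.
rewrite (_ : (fun t => (f t)%:E) = (EFin \o f) \_ `[- a, a]%classic); last first.
  apply/funext => t; rewrite patchE; case: ifPn => //.
  move=> /negP ta; rewrite f0// => tM; apply: ta; rewrite inE /= in_itv /=.
  move: tM => /andP[Mt tM].
  by rewrite (le_trans _ Mt) ?(le_trans tM) ?lerN2// ltW.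
rewrite -integral_mkcond /= (@continuous_FTC2 _ _ F)//.
- rewrite !F0 ?subee// => /andP[h1 h2]; first by move: h1; rewrite lerN2 leNgt aM.
  by move: h2; rewrite leNgt aM.
- by apply: continuous_subspaceT => t; exact: cf.
- have cF t : {for t, continuous F}.
    by apply/differentiable_continuous/derivable1_diffP; have [] := dF t.
  split; first by move=> t _; have [] := dF t.
  + exact/cvg_at_right_filter/cF.
  + exact/cvg_at_left_filter/cF.
- by move=> t _; rewrite derive1E; have [_ ->] := dF t.
Unshelve. all: by end_near. Qed.

Lemma cons_rVD n (p : 'rV[R]_n) t s j :
  cons_rV (p, t) + s *: delta_mx ord0 (lift ord0 j) =
  cons_rV (p + s *: delta_mx ord0 j, t).
Proof.
apply/rowP => k; rewrite !mxE /=; case: unliftP => [l|] ->.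
  by rewrite !mxE /= (inj_eq lift_inj).
by rewrite (negbTE (neq_lift _ _)) mulr0 addr0.
Qed.

Lemma cons_rVD0 n (p : 'rV[R]_n) t :
  cons_rV (p, t) = cons_rV (p, 0) + t *: delta_mx ord0 ord0.
Proof.
apply/rowP => k; rewrite !mxE /=; case: unliftP => [l|] ->.
  by rewrite eq_sym (negbTE (neq_lift _ _)) mulr0 addr0.
by rewrite eqxx mulr1 add0r.
Qed.

(** Off the closed box the function vanishes in a neighbourhood, hence so does
    its derivative along a line. *)
Lemma line_derivative_support n (i : 'I_n) (h dh : 'rV[R]_n -> R) (M : R) :
  (forall x : 'rV_n, ~ (forall i, - M <= x ord0 i <= M) -> h x = 0) ->
  (forall x (t : R), is_derive t 1 (fun s : R => h (x + s *: delta_mx ord0 i))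
                             (dh (x + t *: delta_mx ord0 i))) ->
  (forall x : 'rV_n, ~ (forall i, - M <= x ord0 i <= M) -> dh x = 0).
Proof.
move=> h0 dhE x /existsNP[j xj].
have [_] := dhE x 0; rewrite scale0r addr0 => <-.
rewrite (@near_eq_derive _ _ _ _ (cst 0)) ?derive_cst//.
have cx : {for (0 : R), continuous (fun s : R => x ord0 j + s * (j == i)%:R)}.
  by apply: continuousD; [exact: cvg_cst|apply: continuousM; [exact: cvg_id|exact: cvg_cst]].
have cx0 : x ord0 j + 0 * (j == i)%:R = x ord0 j by rewrite mul0r addr0.
have [tN|tN] := ltP (x ord0 j) (- M).
  have nx : \forall s \near (0 : R), x ord0 j + s * (j == i)%:R < - M.
    by apply: (cx [set y | y < - M]); rewrite /= cx0; exact: lt_nbhsl.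
  near=> s; rewrite h0// => /(_ j); rewrite !mxE eqxx /= => /andP[+ _].
  by rewrite leNgt => /negP; apply; near: s.
have {}tN : M < x ord0 j by rewrite ltNge; apply/negP => tM'; apply: xj; rewrite tN.
have nx : \forall s \near (0 : R), M < x ord0 j + s * (j == i)%:R.
  by apply: (cx [set y | M < y]); rewrite /= cx0; exact: lt_nbhsr.
near=> s; rewrite h0// => /(_ j); rewrite !mxE eqxx /= => /andP[_].
by rewrite leNgt => /negP; apply; near: s.
Unshelve. all: by end_near. Qed.

(** By Fubini it suffices to integrate along the direction of the derivative.
    Regularity is only asked for along lines, in terms of functions of one real
    variable: this is what passes to the slices in the induction on the
    dimension, where [lebesgue_rV] singles out the coordinate 0. *)
Lemma integral_line_partial0 n (i : 'I_n) (h dh : 'rV[R]_n -> R) (M C : R) :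
  measurable_fun setT dh -> (forall x, `|dh x| <= C) ->
  (forall x : 'rV_n, ~ (forall i, - M <= x ord0 i <= M) -> h x = 0) ->
  (forall x (t : R), is_derive t 1 (fun s : R => h (x + s *: delta_mx ord0 i))
                             (dh (x + t *: delta_mx ord0 i))) ->
  (forall x, continuous (fun s : R => dh (x + s *: delta_mx ord0 i))) ->
  (\int[lebesgue_rV R n]_x (dh x)%:E = 0)%E.
Proof.
elim: n => [[]//|n IH] in i h dh *.
move=> mdh dhC h0 dhE cdh.
have dh0 := line_derivative_support h0 dhE.
have idh := bounded_box_integrable mdh dhC dh0.
have icdh := integrable_cons_rV idh.
rewrite integral_cons_rV//.
have [i0|[j ij]] : i = ord0 \/ exists j, i = lift ord0 j.
  by case: (unliftP ord0 i) => [j|] ->; [right; exists j|left].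
- (* integrate first in the direction of the derivative *)
  rewrite -(integral12_prod_meas1 icdh).
  apply: integral0_eq => p _; rewrite /fubini_F /=.
  apply: (@integral_derivative_compact0 (fun t => h (cons_rV (p, t))) _ M) => [t|t|t tM].
  + rewrite cons_rVD0 -i0; under eq_fun do rewrite cons_rVD0 -i0.
    exact: dhE.
  + under eq_fun do rewrite cons_rVD0 -i0.
    exact: cdh.
  + by rewrite h0// => /(_ ord0); rewrite cons_rV0.
- (* integrate first over the slice that contains the direction *)
  rewrite -(integral21_prod_meas1 icdh).
  apply: integral0_eq => t _; rewrite /fubini_G /=.
  apply: (IH j (fun p => h (cons_rV (p, t))) (fun p => dh (cons_rV (p, t)))).
  + apply: measurableT_comp => //; apply: measurableT_comp => //.
    exact: measurable_cons_rV.
  + by move=> p; exact: dhC.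
  + by move=> p pM; apply: h0 => pM'; apply: pM => k; have := pM' (lift ord0 k); rewrite cons_rVS.
  + move=> p s; rewrite -cons_rVD -ij; under eq_fun do rewrite -cons_rVD -ij.
    exact: dhE.
  + move=> p; under eq_fun do rewrite -cons_rVD -ij.
    exact: cdh.
Qed.

End product_integral.

(** * Functions with continuous partial derivatives *)

Section calculus.
Variable R : realType.

Lemma is_derive_line (V : normedModType R) (f : V -> R) (x v : V) (t df : R) :
  is_derive (x + t *: v) v f df <->
  is_derive t 1 (fun s : R => f (x + s *: v)) df.
Proof.
have E : (fun h : R => h^-1 *: ((f \o shift (x + t *: v)) (h *: v) - f (x + t *: v))) =
    (fun h : R => h^-1 *: (((fun s : R => f (x + s *: v)) \o shift t) (h *: 1) -
       f (x + t *: v))).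
  apply/funext => h /=; congr (_ *: (f _ - _)).
  by rewrite [h *: 1]mulr1 scalerDl addrCA.
by split=> -[d e]; apply: DeriveDef; move: d e; rewrite /derivable /derive E.
Qed.

Lemma MVT_between (f df : R -> R) (a b : R) :
  (forall c, Num.min a b <= c <= Num.max a b -> is_derive c 1 f (df c)) ->
  exists2 c, Num.min a b <= c <= Num.max a b & f b - f a = df c * (b - a).
Proof.
wlog ab : a b / a <= b => [H dab|].
  have [ab|] := boolP (a <= b); first exact: H.
  rewrite -ltNge => /ltW ba.
  have [|c cab e] := H b a ba; first by rewrite minC maxC.
  by exists c; [rewrite minC maxC|rewrite -opprB e -mulrN opprB].
rewrite (min_idPl ab) (max_idPr ab) => dab.
have [ | |] := @MVT_segment R f df a b ab.
- by move=> c; rewrite in_itv /= => /andP[/ltW ac /ltW cb]; apply: dab; rewrite ac.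
- apply: derivable_within_continuous => c; rewrite in_itv /= => /dab.
  by move=> [].
- by move=> c; rewrite in_itv /= => cab e; exists c.
Qed.

(** Change the coordinates one at a time from [x] to [x + h]; the mean value
    theorem turns each increment into a partial derivative at a point close to
    [x], which differs from the one at [x] by at most [e]. *)
Lemma partials_expansion n (F : 'rV[R]_n -> R) (x : 'rV[R]_n) :
  (\forall y \near x, forall i, derivable F y (delta_mx ord0 i)) ->
  (forall i, {for x, continuous ('D_(delta_mx ord0 i) F)}) ->
  forall e : R, 0 < e -> \forall h \near (0 : 'rV[R]_n),
    `|F (x + h) - F x - \sum_i h ord0 i * 'D_(delta_mx ord0 i) F x| <=
    e * \sum_i `|h ord0 i|.
Proof.
move=> dF cF e e0.
have : \forall y \near x, forall i, derivable F y (delta_mx ord0 i) /\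
    `|'D_(delta_mx ord0 i) F x - 'D_(delta_mx ord0 i) F y| <= e.
  have cFi (i : 'I_n) : \forall y \near x,
      `|'D_(delta_mx ord0 i) F x - 'D_(delta_mx ord0 i) F y| <= e.
    by move: (cF i) => /cvgrPdist_le /(_ e e0).
  have cF' := filter_forall (nbhs_filter x) cFi.
  by apply: filterS2 dF cF' => y h1 h2 i; split.
move=> /nbhs_ballP[d /= d0 xd].
apply/nbhs_ballP; exists d => //= h [_ hd].
have {}hd i : `|h ord0 i| < d.
  by have := hd ord0 i; rewrite /ball /= mxE sub0r normrN.
(* x with its first k coordinates moved *)
pose z k := x + \row_i (if (i < k)%N then h ord0 i else 0).
have z0 : z 0%N = x by apply/rowP => i; rewrite !mxE addr0.
have zn : z n = x + h by apply/rowP => i; rewrite !mxE ltn_ord.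
have -> : F (x + h) - F x = \sum_(i < n) (F (z i.+1) - F (z i)).
  rewrite -(big_mkord xpredT (fun k => F (z k.+1) - F (z k))).
  by rewrite (telescope_sumr (fun k => F (z k)))// zn z0.
rewrite -sumrB (le_trans (ler_norm_sum _ _ _))// mulr_sumr ler_sum// => i _.
have zS : z i.+1 = z i + h ord0 i *: delta_mx ord0 i.
  apply/rowP => k; rewrite !mxE eqxx /= -addrA; congr (_ + _).
  rewrite ltnS leq_eqVlt (inj_eq val_inj); have [ki|_] := eqVneq k i.
    by rewrite ki ltnn mulr1 add0r.
  by rewrite mulr0 addr0.
have zb t : Num.min 0 (h ord0 i) <= t <= Num.max 0 (h ord0 i) ->
    ball x d (z i + t *: delta_mx ord0 i).
  move=> tb; split => // a k; rewrite /ball /= ord1 !mxE eqxx /=.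
  have -> : x ord0 k - (x ord0 k + (if (k < i)%N then h ord0 k else 0) + t * (k == i)%:R)
     = - ((if (k < i)%N then h ord0 k else 0) + t * (k == i)%:R) by ring.
  rewrite normrN; have [->|ki] := eqVneq k i.
    rewrite ltnn mulr1 add0r (le_lt_trans _ (hd i))//.
    move: tb; have [h0|h0] := leP 0 (h ord0 i).
      by move=> /andP[t0 th]; rewrite !ger0_norm.
    by move=> /andP[th t0]; rewrite !ler0_norm ?lerN2 ?(ltW h0).
  by rewrite mulr0 addr0; case: ifP => _; [exact: hd|rewrite normr0].
have [|c cb] := @MVT_between (fun t => F (z i + t *: delta_mx ord0 i))
   (fun t => 'D_(delta_mx ord0 i) F (z i + t *: delta_mx ord0 i)) 0 (h ord0 i).
  move=> c cb; have [dFc _] := xd _ (zb c cb) i.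
  exact: (is_derive_line F (z i) (delta_mx ord0 i) c _).1 (derivableP dFc).
rewrite scale0r addr0 subr0 zS => ->.
rewrite mulrC -mulrBr normrM mulrC ler_wpM2r// distrC.
by have [] := xd _ (zb c cb) i.
Qed.

Lemma partials_continuous n (F : 'rV[R]_n -> R) (x : 'rV[R]_n) :
  (\forall y \near x, forall i, derivable F y (delta_mx ord0 i)) ->
  (forall i, {for x, continuous ('D_(delta_mx ord0 i) F)}) ->
  {for x, continuous F}.
Proof.
move=> dF cF; rewrite continuous_shift.
have F0 := nbhs_filter (0 : 'rV[R]_n).
apply/(@cvgrPdist_le _ _ _ _ F0) => e e0.
pose D := \sum_i `|'D_(delta_mx ord0 i) F x|.
have D0 : 0 <= D by rewrite sumr_ge0.
pose K := (D + 1) * n%:R + 1.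
have K0 : 0 < K by rewrite ltr_wpDl// mulr_ge0// addr_ge0.
have eK0 : 0 < e / K by rewrite divr_gt0.
have hsmall := @nbhs0_le R 'rV[R]_n _ eK0.
have hexp := partials_expansion dF cF ltr01.
near=> h.
rewrite /= add0r [h + x]addrC distrC.
have hb i : `|h ord0 i| <= e / K.
  suff : `|h| <= e / K.
    apply: le_trans; rewrite [leRHS]/Num.Def.normr /= mx_normrE.
    exact: (le_bigmax _ (fun ij : 'I_1 * 'I_n => `|h ij.1 ij.2|) (ord0, i)).
  by near: h; exact: hsmall.
have he : `|F (x + h) - F x - \sum_i h ord0 i * 'D_(delta_mx ord0 i) F x| <=
    1 * \sum_i `|h ord0 i|.
  by near: h; exact: hexp.
rewrite -(subrK (\sum_i h ord0 i * 'D_(delta_mx ord0 i) F x) (F (x + h) - F x)).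
rewrite (le_trans (ler_normD _ _))// (le_trans (lerD he (ler_norm_sum _ _ _)))//.
rewrite mul1r -big_split /=.
apply: (@le_trans _ _ (\sum_(i < n) (e / K) * (D + 1))).
  apply: ler_sum => i _; rewrite normrM -[X in X + _]mulr1 -mulrDr addrC.
  rewrite ler_pM ?addr_ge0// lerD2r /D (bigD1 i)//= lerDl sumr_ge0//.
rewrite sumr_const card_ord -mulrnAr -mulr_natr mulrAC ler_pdivrMr//.
by rewrite ler_wpM2l ?(ltW e0)// /K lerDl.
Unshelve. all: by end_near. Qed.

(** Along [v] the increment of [F] is zero, so its linear part [t S] is bounded
    by [e |t|] times a constant, for every [e > 0]. *)
Lemma stationary_direction n (F : 'rV[R]_n -> R) (x v : 'rV[R]_n) :
  (\forall y \near x, forall i, derivable F y (delta_mx ord0 i)) ->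
  (forall i, {for x, continuous ('D_(delta_mx ord0 i) F)}) ->
  (\forall t \near (0 : R), F (x + t *: v) = F x) ->
  \sum_i v ord0 i * 'D_(delta_mx ord0 i) F x = 0.
Proof.
move=> dF cF Fv; set S := \sum_i _.
pose A := \sum_i `|v ord0 i|.
suff SA e : 0 < e -> `|S| <= e * A.
  apply/eqP; rewrite -normr_le0; apply/ler_addgt0Pl => e e0; rewrite addr0.
  have A1 : 0 < A + 1 by rewrite ltr_wpDl// sumr_ge0.
  rewrite (le_trans (SA (e / (A + 1)) _)) ?divr_gt0//.
  by rewrite mulrAC ler_pdivrMr// ler_pM2l// lerDl.
move=> e0.
have tv0 : t *: v @[t --> (0 : R)] --> (0 : 'rV[R]_n).
  by rewrite -(scale0r v); apply: cvgZl; exact: cvg_id.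
have E := tv0 _ (partials_expansion dF cF e0).
near (0 : R)^' => t.
have t0 : t != 0 by near: t; exact: nbhs_dnbhs_neq.
have Ft : F (x + t *: v) = F x by near: t; exact: nbhs_dnbhs.
have : `|F (x + t *: v) - F x - \sum_i (t *: v) ord0 i * 'D_(delta_mx ord0 i) F x| <=
    e * \sum_i `|(t *: v) ord0 i|.
  by near: t; apply: nbhs_dnbhs; exact: E.
under eq_bigr do rewrite mxE -mulrA.
under [in X in _ <= X]eq_bigr do rewrite mxE normrM.
rewrite Ft subrr sub0r normrN -mulr_sumr -/S normrM -mulr_sumr -/A mulrCA.
by rewrite ler_pM2l// normr_gt0.
Unshelve. all: by end_near. Qed.

End calculus.

(** * The squared Euclidean norm *)

Section sqnorm.
Variable R : realType.

Definition sqn n (y : 'rV[R]_n) : R := \sum_i y ord0 i ^+ 2.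

Lemma enormE n (y : 'rV[R]_n) : enorm y = Num.sqrt (sqn y).
Proof. by []. Qed.

Lemma sqn_ge0 n (y : 'rV[R]_n) : 0 <= sqn y.
Proof. by apply: sumr_ge0 => i _; exact: sqr_ge0. Qed.

Lemma sqn_gt0 n (y : 'rV[R]_n) : (0 < sqn y) = (y != 0).
Proof.
rewrite lt_def sqn_ge0 andbT; congr negb; apply/eqP/eqP => [|->]; last first.
  by rewrite /sqn big1// => i _; rewrite mxE expr0n.
move=> /eqP; rewrite psumr_eq0 => [/allP y0|i _]; last exact: sqr_ge0.
apply/rowP => i; rewrite mxE; apply/eqP; rewrite -sqrf_eq0.
by apply: y0; rewrite mem_index_enum.
Qed.

Lemma is_derive_coord n (y v : 'rV[R]_n) i :
  is_derive y v (fun z : 'rV[R]_n => z ord0 i) (v ord0 i).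
Proof.
rewrite -[y]addr0 -(scale0r v).
apply: (is_derive_line (fun z : 'rV[R]_n => z ord0 i) y v 0 _).2.
under eq_fun do rewrite mxE [(_ *: v) _ _]mxE.
apply: (is_derive_eq (is_deriveD (is_derive_cst _ _ _)
  (is_deriveM (is_derive_id _ _) (is_derive_cst _ _ _)))).
by rewrite scaler0 !add0r [LHS]mulr1.
Qed.

Lemma is_derive_compR (V : normedModType R) (s : V -> R) (w : R -> R) (y v : V) (ds dw : R) :
  is_derive y v s ds -> is_derive (s y) 1 w dw ->
  is_derive y v (w \o s) (dw * ds).
Proof.
move=> hs hw; rewrite -[y]addr0 -(scale0r v).
apply: (is_derive_line (w \o s) y v 0 _).2.
have hs' : is_derive (0 : R) 1 (fun t : R => s (y + t *: v)) ds.
  by apply: (is_derive_line s y v 0 ds).1; rewrite scale0r addr0.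
apply: (@is_derive1_comp _ w (fun t : R => s (y + t *: v))) => //.
by rewrite scale0r addr0.
Qed.

Lemma is_derive_sqn n (y : 'rV[R]_n) j :
  is_derive y (delta_mx ord0 j) (@sqn n) (2 * y ord0 j).
Proof.
have H i : is_derive y (delta_mx ord0 j) (fun z : 'rV[R]_n => z ord0 i ^+ 2)
    ((y ord0 j *+ 2) * (j == i)%:R).
  have d := is_derive_coord y (delta_mx ord0 j) i.
  apply: (is_derive_eq (is_deriveM d d)).
  rewrite !mxE eqxx /= eq_sym /GRing.scale /= -mulrDl.
  by have [->//|] := eqVneq; rewrite ?mulr1 ?mulr0.
have := is_derive_sum H.
rewrite (_ : \sum_i _ = @sqn n); last by apply/funext => z; rewrite fct_sumE.
move=> h; apply: (is_derive_eq h).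
rewrite (bigD1 j)//= big1 => [|i /negbTE ij]; last by rewrite eq_sym ij mulr0.
by rewrite eqxx mulr1 addr0 mulr_natl.
Qed.

Lemma continuous_coord_rV n (i : 'I_n) : continuous (fun y : 'rV[R]_n => y ord0 i).
Proof. exact: coord_continuous. Qed.

Lemma continuous_sqn n : continuous (@sqn n).
Proof.
apply: continuous_big => [|i _]; first exact: add_continuous.
by move=> y; apply: (continuousM (@continuous_coord_rV n i y) (@continuous_coord_rV n i y)).
Qed.

Lemma integral_partial0 n (i : 'I_n) (h dh : 'rV[R]_n -> R) (M : R) :
  continuous dh ->
  (forall x, is_derive x (delta_mx ord0 i) h (dh x)) ->
  (forall x : 'rV_n, ~ (forall i, - M <= x ord0 i <= M) -> h x = 0) ->
  (lebesgue_rV R n).-integrable setT (EFin \o dh) /\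
  (\int[lebesgue_rV R n]_x (dh x)%:E = 0)%E.
Proof.
move=> cdh dhE h0.
have mdh : measurable_fun setT dh.
  by apply: continuous_measurable_rV => [|x _]; [exact: openT|exact: cdh].
have dhL x (t : R) : is_derive t 1 (fun s : R => h (x + s *: delta_mx ord0 i))
                             (dh (x + t *: delta_mx ord0 i)).
  exact: (is_derive_line h x _ t _).1.
have dh0 := line_derivative_support h0 dhL.
have [C dhC] : exists C, forall x, `|dh x| <= C.
  pose B := [set x : 'rV[R]_n | forall i, `[- M, M]%classic (x ord0 i)].
  have cB : compact B by apply: (@rV_compact _ _ (fun=> `[- M, M]%classic)) => _; exact: segment_compact.
  have /compact_bounded[C [_ hC]] : compact (dh @` B).
    by apply: continuous_compact => //; exact: continuous_subspaceT.
  exists (`|C| + 1) => x.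
  have C1 : C < `|C| + 1 by rewrite ltr_pwDr// ler_norm.
  have [xB|xB] := pselect (B x).
    by apply: (hC _ C1); exists x.
  by rewrite dh0 ?normr0 ?addr_ge0// => xM; apply: xB.
split; first exact: (bounded_box_integrable mdh dhC dh0).
apply: (integral_line_partial0 mdh dhC h0 dhL) => x t.
apply: continuous_comp; last exact: cdh.
apply: continuousD; first exact: cvg_cst.
by apply: cvgZl; exact: cvg_id.
Qed.

End sqnorm.

(** * A weighted tangential vector field *)

Section tangential.
Variables (R : realType) (n : nat).
Local Notation V := 'rV[R]_n.+1.
Local Notation e_ j := (delta_mx ord0 j : V).
Variable G : V -> R.
Hypothesis dG : forall (x : V) j, x != 0 -> derivable G x (e_ j).
Hypothesis cdG : forall (x : V) j, x != 0 -> {for x, continuous ('D_(e_ j) G)}.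
Hypothesis cG : forall x : V, x != 0 -> {for x, continuous G}.
Hypothesis euler : forall x : V, x != 0 -> \sum_j x ord0 j * 'D_(e_ j) G x = 0.
Variables (w dw : R -> R) (e L : R).
Hypothesis e0 : 0 < e.
Hypothesis L1 : 1 <= L.
Hypothesis hw : forall s : R, 0 < s -> is_derive s 1 w (dw s).
Hypothesis cdw : forall s : R, 0 < s -> {for s, continuous dw}.
Hypothesis w_small : forall s, s < e -> w s = 0.
Hypothesis w_large : forall s, L <= s -> w s = 0.
Variable i : 'I_n.+1.

(* The j-th component of the field, and its j-th partial derivative.  The
   matrix delta_ij |y|^2 - y_i y_j is |y|^2 times the projection onto the
   hyperplane orthogonal to y. *)
Let tangent j (y : V) := w (sqn y) * (((i == j)%:R * sqn y - y ord0 i * y ord0 j) * G y).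
Let dtangent j (y : V) :=
  dw (sqn y) * (2 * y ord0 j) * (((i == j)%:R * sqn y - y ord0 i * y ord0 j) * G y) +
  w (sqn y) * (((i == j)%:R * (2 * y ord0 j) - ((i == j)%:R * y ord0 j + y ord0 i)) * G y +
     ((i == j)%:R * sqn y - y ord0 i * y ord0 j) * 'D_(e_ j) G y).

Lemma near_sqn_small : \forall y \near (0 : V), sqn y < e.
Proof.
have : {for (0 : V), continuous (@sqn R n.+1)} by exact: continuous_sqn.
move=> /(_ [set s | s < e]); apply.
rewrite /= (_ : sqn 0 = 0); first exact: lt_nbhsl.
by rewrite /sqn big1// => k _; rewrite mxE expr0n.
Qed.

Lemma dw_small s : 0 < s < e -> dw s = 0.
Proof.
move=> /andP[s0 se]; have [_ <-] := hw s0.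
rewrite (@near_eq_derive _ _ _ _ (cst 0)) ?derive_cst//.
near=> t; rewrite w_small//; near: t; exact: lt_nbhsl.
Unshelve. all: by end_near. Qed.

Lemma tangent_small j y : sqn y < e -> tangent j y = 0.
Proof. by move=> ye; rewrite /tangent w_small// mul0r. Qed.

(** At the origin the values of [dw] and ['D_(e_ j) G] are arbitrary, but they
    are multiplied by coordinates of [y] or by [w 0]. *)
Lemma dtangent_small j y : sqn y < e -> dtangent j y = 0.
Proof.
move=> ye; rewrite /dtangent w_small// mul0r addr0.
have [->|y0] := eqVneq y 0; first by rewrite mxE mulr0 mulr0 mul0r.
by rewrite dw_small ?sqn_gt0 ?y0// !mul0r.
Qed.

Lemma is_derive_tangent j y : is_derive y (e_ j) (tangent j) (dtangent j y).
Proof.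
have [->|y0] := eqVneq y 0.
  rewrite dtangent_small; last exact: nbhs_singleton near_sqn_small.
  apply: (@near_eq_is_derive R V R (fun=> 0) _ _ _ _ _ (is_derive_cst (0 : R) (0 : V) (e_ j))).
  by apply: filterS near_sqn_small => z ze; rewrite tangent_small.
have s0 : 0 < sqn y by rewrite sqn_gt0.
have d1 := is_derive_compR (is_derive_sqn y j) (hw s0).
have d2 := is_derive_sqn y j.
have d3 k := is_derive_coord y (e_ j) k.
have d4 := derivableP (@dG y j y0).
have d5 : is_derive y (e_ j) (fun z : V => (i == j)%:R * sqn z - z ord0 i * z ord0 j)
    ((i == j)%:R * (2 * y ord0 j) - ((i == j)%:R * y ord0 j + y ord0 i)).
  apply: (is_derive_eq (is_deriveB (is_deriveZ (i == j)%:R d2) (is_deriveM (d3 i) (d3 j)))).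
  rewrite !mxE !eqxx /= /GRing.scale /=; ring.
apply: (is_derive_eq (is_deriveM d1 (is_deriveM d5 d4))).
have mulE (f g : V -> R) z : (f * g) z = f z * g z by [].
rewrite /dtangent /GRing.scale /= mulE; ring.
Qed.

Lemma continuous_dtangent j : continuous (dtangent j).
Proof.
move=> y; have [->|y0] := eqVneq y 0.
  have d0 : dtangent j 0 = 0 by rewrite dtangent_small//; exact: nbhs_singleton near_sqn_small.
  have dn : \forall z \near (0 : V), dtangent j z = dtangent j 0.
    by apply: filterS near_sqn_small => z ze; rewrite d0 dtangent_small.
  exact: cvg_near_cst dn.
have s0 : 0 < sqn y by rewrite sqn_gt0.
have c1 : {for y, continuous (w \o @sqn R n.+1)}.
  apply: continuous_comp; first exact: continuous_sqn.
  by apply/differentiable_continuous/derivable1_diffP; have [] := hw s0.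
have c2 : {for y, continuous (dw \o @sqn R n.+1)}.
  apply: continuous_comp; first exact: continuous_sqn.
  exact: cdw.
have c3 k : {for y, continuous (fun z : V => z ord0 k)} by exact: continuous_coord_rV.
have c4 := @cdG y j y0.
have c5 := @cG y y0.
have c6 : {for y, continuous (@sqn R n.+1)} by exact: continuous_sqn.
have c7 (a : R) : {for y, continuous (fun _ : V => a)} by exact: (@cst_continuous V R a).
have c8 := continuousB (continuousM (c7 (i == j)%:R) c6) (continuousM (c3 i) (c3 j)).
have c9 := continuousB (continuousM (c7 (i == j)%:R) (continuousM (c7 2) (c3 j)))
   (continuousD (continuousM (c7 (i == j)%:R) (c3 j)) (c3 i)).
exact: (continuousD (continuousM (continuousM c2 (continuousM (c7 2) (c3 j))) (continuousM c8 c5))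
 (continuousM c1 (continuousD (continuousM c9 c5) (continuousM c8 c4)))).
Qed.

Lemma tangent_support j (y : V) : ~ (forall i, - L <= y ord0 i <= L) -> tangent j y = 0.
Proof.
move=> /existsNP[k yk]; rewrite /tangent w_large ?mul0r//.
apply: (@le_trans _ _ (y ord0 k ^+ 2)).
  have Lk : L <= `|y ord0 k|.
    by move/negP: yk; rewrite -ler_norml -ltNge => /ltW.
  rewrite -(@real_normK _ (y ord0 k))// ?num_real// expr2 (le_trans Lk)//.
  by rewrite ler_peMr// (le_trans L1).
by rewrite /sqn (bigD1 k)//= lerDl sumr_ge0// => l _; exact: sqr_ge0.
Qed.

(** The derivative of the weight contributes the scalar product of the field
    with [y], which is zero; Euler's relation removes the [y_i y_j] part of the
    term with the gradient of [G]. *)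
Lemma sum_dtangent (y : V) : \sum_j dtangent j y =
  w (sqn y) * (sqn y * 'D_(e_ i) G y - n%:R * y ord0 i * G y).
Proof.
have [->|y0] := eqVneq y 0.
  have s0 := nbhs_singleton near_sqn_small.
  by rewrite big1 ?w_small ?mul0r// => j _; rewrite dtangent_small.
have sum_delta (F : 'I_n.+1 -> R) : \sum_j (i == j)%:R * F j = F i.
  rewrite (bigD1 i)//= eqxx mul1r big1 ?addr0// => k /negbTE.
  by rewrite eq_sym => ->; rewrite mul0r.
rewrite big_split /=.
rewrite (eq_bigr (fun j => (dw (sqn y) * 2 * G y) *
   ((i == j)%:R * (sqn y * y ord0 j) - y ord0 i * y ord0 j ^+ 2))); last first.
  by move=> j _; ring.
rewrite -mulr_sumr sumrB sum_delta -mulr_sumr -/(sqn y) [sqn y * _]mulrC subrr mulr0 add0r.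
rewrite -mulr_sumr; congr (_ * _).
rewrite (eq_bigr (fun j => (i == j)%:R * (y ord0 j * G y + sqn y * 'D_(e_ j) G y)
  - y ord0 i * G y - y ord0 i * (y ord0 j * 'D_(e_ j) G y))); last first.
  by move=> j _; ring.
rewrite !sumrB sum_delta sumr_const card_ord -mulr_sumr euler// mulr0 subr0.
rewrite -[(_ * _) *+ n.+1]mulr_natl -natr1; ring.
Qed.

Lemma integral_tangential :
  (lebesgue_rV R n.+1).-integrable setT (fun y : V => (w (sqn y) *
    (sqn y * 'D_(e_ i) G y - n%:R * y ord0 i * G y))%:E) /\
  (\int[lebesgue_rV R n.+1]_y (w (sqn y) *
    (sqn y * 'D_(e_ i) G y - n%:R * y ord0 i * G y))%:E = 0)%E.
Proof.
have H j := integral_partial0 (@continuous_dtangent j) (@is_derive_tangent j)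
  (@tangent_support j).
have E : (fun y : V => (w (sqn y) *
    (sqn y * 'D_(e_ i) G y - n%:R * y ord0 i * G y))%:E) =
    (fun y => \sum_j (dtangent j y)%:E)%E.
  by apply/funext => y; rewrite sumEFin sum_dtangent.
rewrite E; split.
  by apply: integrable_sum => //= j _; have [] := H j.
rewrite integral_sum//=; last by move=> j; have [] := H j.
by rewrite big1// => j _; have [] := H j.
Qed.

End tangential.

(** * Integration over the sphere *)

Section sphere_geometry.
Variables (R : realType) (n : nat).
Local Notation V := 'rV[R]_n.+1.
Implicit Types x y : V.

Lemma sqr_enorm m (y : 'rV[R]_m) : enorm y ^+ 2 = sqn y.
Proof. by rewrite enormE sqr_sqrtr// sqn_ge0. Qed.

Lemma enorm_ge0 m (y : 'rV[R]_m) : 0 <= enorm y.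
Proof. exact: sqrtr_ge0. Qed.

Lemma enorm_gt0 m (y : 'rV[R]_m) : (0 < enorm y) = (y != 0).
Proof. by rewrite enormE sqrtr_gt0 sqn_gt0. Qed.

Lemma enormZ m (c : R) (y : 'rV[R]_m) : enorm (c *: y) = `|c| * enorm y.
Proof.
rewrite !enormE -sqrtr_sqr -sqrtrM ?sqr_ge0//; congr Num.sqrt.
by rewrite /sqn mulr_sumr; apply: eq_bigr => i _; rewrite mxE exprMn.
Qed.

Lemma sphere_neq0 x : sphere R n x -> x != 0.
Proof. by rewrite /sphere /= => x1; rewrite -enorm_gt0 x1. Qed.

Lemma unit_vec_sphere x : sphere R n x -> unit_vec x = x.
Proof. by rewrite /sphere /unit_vec /= => ->; rewrite invr1 scale1r. Qed.

Lemma sphere_unit_vec y : y != 0 -> sphere R n (unit_vec y).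
Proof.
rewrite -enorm_gt0 => y0; rewrite /sphere /unit_vec /= enormZ ger0_norm ?invr_ge0 ?ltW//.
by rewrite mulVf// gt_eqF.
Qed.

Lemma sphere_unit_vecE y : sphere R n (unit_vec y) <-> y != 0.
Proof.
split; last exact: sphere_unit_vec.
by apply: contraPneq => ->; rewrite /unit_vec scaler0 => /sphere_neq0/eqP.
Qed.

Lemma unit_vecZ (c : R) y : 0 < c -> unit_vec (c *: y) = unit_vec y.
Proof.
move=> c0; rewrite /unit_vec enormZ gtr0_norm// scalerA invfM mulrAC mulVf ?mul1r//.
by rewrite gt_eqF.
Qed.

Lemma continuous_enorm m : continuous (@enorm R m).
Proof.
move=> y.
exact: (continuous_comp (@continuous_sqn R m y) (@sqrt_continuous R (sqn y))).
Qed.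

Lemma continuous_unit_vec y : y != 0 -> {for y, continuous (@unit_vec R n.+1)}.
Proof.
rewrite -enorm_gt0 => y0.
have cid : (id @ nbhs y --> y) by exact: cvg_id.
exact: (cvgZ (cvgV (lt0r_neq0 y0) (@continuous_enorm n.+1 y)) cid).
Qed.

Lemma open_neq0 : open [set y : V | y != 0].
Proof.
rewrite (_ : mkset _ = @sqn R n.+1 @^-1` [set s | 0 < s]).
  by apply: open_comp; [move=> y _; exact: continuous_sqn|exact: open_gt].
by apply/seteqP; split => y /=; rewrite sqn_gt0.
Qed.

Lemma near_neq0 y : y != 0 -> \forall z \near y, z != 0.
Proof. by move=> y0; apply: open_nbhs_nbhs; split; [exact: open_neq0|]. Qed.

Lemma measurable_sphere : measurable (sphere R n).
Proof.
rewrite (_ : sphere R n = setT `&` @enorm R n.+1 @^-1` [set 1]).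
  exact: measurable_enorm.
by apply/seteqP; split => x //= [].
Qed.

Lemma compact_sphere : compact (sphere R n).
Proof.
apply: (@subclosed_compact _ _ [set v : V | forall i, `[- 1, 1]%classic (v ord0 i)]).
- apply: (@preimage_closed _ _ (@enorm R n.+1) [set 1]) => [y _|].
    exact: continuous_enorm.
  exact: closed_eq.
- by apply: (@rV_compact _ _ (fun=> `[- 1 : R, 1]%classic)) => _; exact: segment_compact.
- move=> x /= x1 i; rewrite in_itv /= -ler_norml -sqrtr_sqr -x1 enormE ler_sqrt ?sqn_ge0//.
  by rewrite /sqn (bigD1 i)//= lerDl sumr_ge0// => j _; exact: sqr_ge0.
Qed.

(** Continuity of the restriction of [k] to the sphere, phrased like
    [C1_sphere]: the values of [k] off the sphere do not matter. *)
Definition sphere_continuous (k : V -> R) :=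
  forall y, y != 0 -> {for y, continuous (radial_ext k)}.

Lemma sphere_continuous_bounded k : sphere_continuous k ->
  exists C, forall x, sphere R n x -> `|k x| <= C.
Proof.
move=> ck.
have /compact_bounded[C [_ hC]] : compact (radial_ext k @` sphere R n).
  apply: continuous_compact; last exact: compact_sphere.
  apply: continuous_in_subspaceT => y; rewrite inE => /sphere_neq0; exact: ck.
exists (`|C| + 1) => x x1.
rewrite -[x in k x](unit_vec_sphere x1).
by apply: (hC (`|C| + 1)); [rewrite ltr_pwDr// ler_norm|exists x].
Qed.

Lemma sphere_continuous_measurable k : sphere_continuous k ->
  measurable_fun (sphere R n) k.
Proof.
move=> ck; apply: (@eq_measurable_fun _ _ _ _ _ (radial_ext k)).
  by move=> x; rewrite inE => x1; rewrite /radial_ext unit_vec_sphere.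
apply: (@measurable_funS _ _ _ _ [set y : V | y != 0]).
- by apply: open_measurable_rV; exact: open_neq0.
- by move=> x; exact: sphere_neq0.
- by apply: continuous_measurable_rV; [exact: open_neq0|exact: ck].
Qed.

Lemma sphere_continuous_integrable k : sphere_continuous k ->
  (sphere_measure R n).-integrable (sphere R n) (EFin \o k).
Proof.
move=> ck; have [C kC] := sphere_continuous_bounded ck.
apply: measurable_bounded_integrable.
- exact: measurable_sphere.
- by rewrite (le_lt_trans (probability_le1 _ measurable_sphere))// ltry.
- exact: sphere_continuous_measurable.
- exists C; split; first exact: num_real.
  by move=> y Cy x x1 /=; rewrite (le_trans (kC x x1))// ltW.
Qed.

(** The cone over the sphere inside the unit ball. *)
Definition punctured_ball := unit_ball R n.+1 `&` [set y | y != 0].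

Lemma measurable_punctured_ball : measurable punctured_ball.
Proof.
apply: measurableI; first exact: measurable_unit_ball.
by apply: open_measurable_rV; exact: open_neq0.
Qed.

Lemma ge0_integral_mrestr d (T : measurableType d) (mu : {measure set T -> \bar R})
    (D : set T) (mD : measurable D) (f : T -> \bar R) :
  measurable_fun setT f -> (forall t, 0 <= f t)%E ->
  (\int[mrestr mu mD]_t f t = \int[mu]_(t in D) f t)%E.
Proof.
move=> mf f0; rewrite -(setUv D) ge0_integral_setU//=.
- rewrite (@eq_measure_integral _ _ _ D mu (mrestr mu mD)) => [|A mA AD].
    rewrite [X in (_ + X)%E](_ : _ = 0%E) ?adde0//.
    apply: null_set_integral => //.
    - exact: measurableC.
    - exact: measurable_funTS.
    - by transitivity (mu (~` D `&` D)) => //; rewrite setICl measure0.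
  by transitivity (mu (A `&` D)) => //; rewrite setIidl.
- exact: measurableC.
- by rewrite setUv.
- by apply/disj_setPS; rewrite setICr.
Qed.

(** The surface measure is the image under [unit_vec] of the restriction of
    Lebesgue measure to the unit ball, normalized; the origin is the only point
    of the ball whose image is not on the sphere. *)
Lemma ge0_integral_sphere (f : V -> \bar R) :
  measurable_fun (sphere R n) f -> (forall x, sphere R n x -> 0 <= f x)%E ->
  (\int[sphere_measure R n]_(x in sphere R n) f x =
   (ball_volume R n.+1)^-1%:E *
   \int[lebesgue_rV R n.+1]_(y in punctured_ball) f (unit_vec y))%E.
Proof.
move=> mf f0.
have mS := measurable_sphere.
have m1 := @measurable_unit_vec R n.+1.
have mB := @measurable_unit_ball R n.+1.
have c0 : (0 <= (ball_volume R n.+1)^-1)%R by rewrite invr_ge0 ltW// ball_volume_gt0.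
pose mu1 : {measure set V -> \bar R} := mrestr (lebesgue_rV R n.+1) mB.
pose mu2 : {measure set V -> \bar R} := pushforward mu1 (@unit_vec R n.+1).
pose F := f \_ (sphere R n).
have mF : measurable_fun setT F by apply/(measurable_restrictT f mS).
have F0 x : (0 <= F x)%E.
  by rewrite /F patchE; case: ifPn => //; rewrite inE; exact: f0.
rewrite integral_mkcond -/F.
rewrite (@eq_measure_integral _ _ _ _ (mscale (NngNum c0) (mu2 m1))) => [|//].
have E1 := @ge0_integral_mscale _ _ R (mu2 m1) setT measurableT (NngNum c0) F
  mF (fun x _ => F0 x).
have E2 : (\int[mu2 m1]_x F x = \int[mu1]_t (F \o @unit_vec R n.+1) t)%E :=
  @ge0_integral_pushforward _ _ _ _ R _ m1 mu1 setT F measurableT mF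
    (fun x _ => F0 x).
have E3 : (\int[mu1]_t (F \o @unit_vec R n.+1) t =
    \int[lebesgue_rV R n.+1]_(t in unit_ball R n.+1) (F \o @unit_vec R n.+1) t)%E.
  have mFu : measurable_fun setT (F \o @unit_vec R n.+1) by exact: measurableT_comp.
  exact: (ge0_integral_mrestr (lebesgue_rV R n.+1) mB mFu (fun t => F0 (unit_vec t))).
have E4 : (\int[lebesgue_rV R n.+1]_(t in unit_ball R n.+1) (F \o @unit_vec R n.+1) t =
    \int[lebesgue_rV R n.+1]_(y in punctured_ball) f (unit_vec y))%E.
  rewrite integral_mkcondr; apply: eq_integral => y _.
  rewrite /F /comp patchE [RHS]patchE; congr (if _ then _ else _).
  by apply/idP/idP; rewrite !inE => /sphere_unit_vecE.
have E5 := etrans E2 (etrans E3 E4).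
exact: etrans E1 (congr1 (mule _) E5).
Qed.

(** The formula for nonnegative functions is applied to the positive and
    negative parts. *)
Lemma sint_eq0 (k : V -> R) : sphere_continuous k ->
  (\int[lebesgue_rV R n.+1]_(y in punctured_ball) (k (unit_vec y))%:E = 0)%E ->
  sint k = 0.
Proof.
move=> ck k0; rewrite /sint /Rintegral.
pose f : V -> \bar R := EFin \o k.
have mf : measurable_fun (sphere R n) f.
  by apply/measurable_EFinP; exact: sphere_continuous_measurable.
have Ep := ge0_integral_sphere (measurable_funepos mf) (fun x _ => funepos_ge0 f x).
have En := ge0_integral_sphere (measurable_funeneg mf) (fun x _ => funeneg_ge0 f x).
have E : (\int[sphere_measure R n]_(x in sphere R n) f x =
  \int[sphere_measure R n]_(x in sphere R n) f^\+ x -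
  \int[sphere_measure R n]_(x in sphere R n) f^\- x)%E by rewrite -integralE.
rewrite -/f E Ep En.
have k0' : (\int[lebesgue_rV R n.+1]_(y in punctured_ball) f^\+ (unit_vec y) -
  \int[lebesgue_rV R n.+1]_(y in punctured_ball) f^\- (unit_vec y) = 0)%E.
  rewrite -[RHS]k0 [RHS]integralE.
  congr (_ - _)%E; apply: eq_integral => y _.
    by rewrite !funeposE.
  by rewrite !funenegE.
move: k0'.
have : (0 <= \int[lebesgue_rV R n.+1]_(y in punctured_ball) f^\- (unit_vec y))%E.
  exact: integral_ge0.
have : (0 <= \int[lebesgue_rV R n.+1]_(y in punctured_ball) f^\+ (unit_vec y))%E.
  exact: integral_ge0.
case: (integral _ _ _) => [a||] //; case: (integral _ _ _) => [b||] // _ _.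
by rewrite -EFinB => -[ab]; rewrite -!EFinM -EFinB /= -mulrBr ab mulr0.
Qed.

End sphere_geometry.

(** * Gradients of functions of class C1 on the sphere *)

Section sphere_C1.
Variables (R : realType) (n : nat).
Local Notation V := 'rV[R]_n.+1.
Local Notation e_ j := (delta_mx ord0 j : V).
Variable g : V -> R.
Hypothesis hg : C1_sphere g.
Local Notation G := (radial_ext g).

Lemma radial_extZ (T : Type) (h : V -> T) (c : R) (y : V) : 0 < c ->
  radial_ext h (c *: y) = radial_ext h y.
Proof. by move=> c0; rewrite /radial_ext unit_vecZ. Qed.

Lemma C1_near_derivable (x : V) : x != 0 ->
  \forall y \near x, forall i, derivable G y (e_ i).
Proof.
by move=> x0; apply: filterS (near_neq0 x0) => y y0 i; have [] := hg i y0.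
Qed.

Lemma C1_sphere_continuous : sphere_continuous g.
Proof.
move=> x x0; apply: partials_continuous; first exact: C1_near_derivable.
by move=> i; have [] := hg i x0.
Qed.

(** [G] is constant on rays. *)
Lemma C1_euler (x : V) : x != 0 -> \sum_j x ord0 j * 'D_(e_ j) G x = 0.
Proof.
move=> x0; apply: stationary_direction.
- exact: C1_near_derivable.
- by move=> i; have [] := hg i x0.
- near=> t.
  rewrite -[x in x + _]scale1r -scalerDl radial_extZ//.
  rewrite -ltrBlDl sub0r; near: t; apply: lt_nbhsr.
  by rewrite oppr_lt0.
Unshelve. all: by end_near. Qed.

(** The derivatives of a function homogeneous of degree 0 are homogeneous of
    degree -1. *)
Lemma partial_radial_extZ (c : R) (y : V) i : 0 < c -> y != 0 ->
  'D_(e_ i) G (c *: y) = c^-1 * 'D_(e_ i) G y.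
Proof.
move=> c0 y0; have cy0 : c *: y != 0 by rewrite scaler_eq0 gt_eqF.
have [dG1 _] := hg i cy0.
have d1 : is_derive (0 : R) 1 (fun s : R => G (c *: y + s *: e_ i)) ('D_(e_ i) G (c *: y)).
  apply: (is_derive_line G (c *: y) (e_ i) 0 _).1; rewrite scale0r addr0.
  exact: derivableP.
have d2 : is_derive (0 : R) 1 (fun s : R => c * s) c.
  apply: (is_derive_eq (is_deriveM (is_derive_cst c _ _) (is_derive_id _ _))).
  by rewrite scaler0 addr0 [LHS]mulr1.
have d3 : is_derive (0 : R) 1 (fun s : R => G (y + s *: e_ i)) ('D_(e_ i) G (c *: y) * c).
  rewrite (_ : (fun s : R => _) = (fun s : R => G (c *: y + s *: e_ i)) \o (fun s => c * s)).
    by apply: is_derive1_comp; rewrite mulr0.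
  apply/funext => s /=; rewrite -(radial_extZ g (y + s *: e_ i) c0).
  by rewrite scalerDr scalerA.
have := (is_derive_line G y (e_ i) 0 _).2 d3.
rewrite scale0r addr0 => -[_ ->].
by rewrite mulrCA mulVf ?mulr1// gt_eqF.
Qed.

Lemma sgrad_unit_vec (y : V) i : y != 0 ->
  sgrad g (unit_vec y) ord0 i = enorm y * 'D_(e_ i) G y.
Proof.
move=> y0; rewrite mxE partial_radial_extZ ?invrK// invr_gt0 enorm_gt0//.
Qed.

Lemma sgrad_sphere_continuous i : sphere_continuous (fun x => sgrad g x ord0 i).
Proof.
move=> y y0; have uy0 := sphere_neq0 (sphere_unit_vec y0).
have -> : radial_ext (fun x => sgrad g x ord0 i) = 'D_(e_ i) G \o @unit_vec R n.+1.
  by apply/funext => z; rewrite /radial_ext mxE.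
apply: continuous_comp; first exact: continuous_unit_vec.
by have [] := hg i uy0.
Qed.

End sphere_C1.

(** * Radial cutoff functions *)

Section cutoff.
Variable R : realType.

Definition ramp2 (t : R) : R := Num.max 0 t ^+ 2.

Lemma is_derive_ramp2 (t : R) : is_derive t 1 ramp2 (2 * Num.max 0 t).
Proof.
have [t0|t0|<-] := ltgtP 0 t.
  apply: (@near_eq_is_derive R R R (fun s => s * s)).
    near=> s; rewrite /ramp2 (max_idPr _) ?expr2// ltW//.
    by near: s; exact: lt_nbhsr.
  apply: (is_derive_eq (is_deriveM (is_derive_id _ _) (is_derive_id _ _))).
  by rewrite /GRing.scale /= mulr1 mulr_natl.
- rewrite mulr0.
  apply: (@near_eq_is_derive R R R (fun s => 0)) (is_derive_cst _ _ _).
  near=> s; rewrite /ramp2 (max_idPl _) ?expr0n//= ltW//.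
  by near: s; exact: lt_nbhsl.
- rewrite ?maxxx mulr0.
  have H : (fun h : R => h^-1 *: ((ramp2 \o shift (0 : R)) (h *: (1 : R)) - ramp2 0)) @ 0^' --> (0 : R).
    apply: (@cvg_to_0_linear _ _ 1 1) => // h /andP[h0 _].
    have h0' : h != 0 by rewrite -normr_gt0.
    rewrite /= /ramp2 maxxx expr0n /= subr0 addr0 [h *: _]mulr1 normrM normfV mul1r.
    rewrite ler_pdivrMl// -expr2 normrX lerXn2r ?nnegrE//.
    by have [h1|h1] := leP 0 h; rewrite ?normr0.
  by apply: DeriveDef; [apply/cvg_ex; exists 0|apply: cvg_lim].
Unshelve. all: by end_near. Qed.

Lemma continuous_ramp : continuous (fun t : R => Num.max 0 t).
Proof.
move=> t; apply: (@continuous_max _ _ (cst 0) id); [exact: cvg_cst|exact: cvg_id].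
Qed.

(** A transition of class C1 from 0, on the negative reals, to 1, on the reals
    above 1: for [t >= 1] the inner ramp is at least 1, so the outer one is 0. *)
Definition smoothstep (t : R) : R := 1 - ramp2 (1 - ramp2 t).
Definition dsmoothstep (t : R) : R := 2 * Num.max 0 (1 - ramp2 t) * (2 * Num.max 0 t).

Lemma is_derive_smoothstep (t : R) : is_derive t 1 smoothstep (dsmoothstep t).
Proof.
have d1 : is_derive t 1 (fun s => 1 - ramp2 s) (- (2 * Num.max 0 t)).
  apply: (is_derive_eq (is_deriveB (is_derive_cst _ _ _) (is_derive_ramp2 t))).
  by rewrite sub0r.
have d2 := @is_derive1_comp R ramp2 (fun s => 1 - ramp2 s) t _ _
  (is_derive_ramp2 (1 - ramp2 t)) d1.
apply: (is_derive_eq (is_deriveB (is_derive_cst _ _ _) d2)).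
by rewrite sub0r mulrN opprK.
Qed.

Lemma continuous_ramp2 : continuous ramp2.
Proof.
by move=> t; apply/differentiable_continuous/derivable1_diffP; have [] := is_derive_ramp2 t.
Qed.

Lemma continuous_dsmoothstep : continuous dsmoothstep.
Proof.
move=> t.
have c2 : {for t, continuous (fun _ : R => 2 : R)} by exact: cst_continuous.
have c1 : {for t, continuous (fun _ : R => 1 : R)} by exact: cst_continuous.
have cr : {for t, continuous (fun s : R => Num.max 0 (1 - ramp2 s))}.
  apply: (@continuous_comp _ _ _ (fun s : R => 1 - ramp2 s) (Num.max 0)).
    exact: (continuousB c1 (@continuous_ramp2 t)).
  exact: continuous_ramp.
exact: (continuousM (continuousM c2 cr) (continuousM c2 (@continuous_ramp t))).
Qed.

Lemma smoothstep_le0 (t : R) : t <= 0 -> smoothstep t = 0.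
Proof.
by move=> t0; rewrite /smoothstep /ramp2 (max_idPl t0) expr0n subr0 (max_idPr _)// expr1n subrr.
Qed.

Lemma smoothstep_ge1 (t : R) : 1 <= t -> smoothstep t = 1.
Proof.
move=> t1; rewrite /smoothstep /ramp2 (max_idPr (le_trans ler01 t1)) (max_idPl _) ?expr0n ?subr0//.
by rewrite subr_le0 exprn_ege1.
Qed.

Lemma smoothstep_ge0_le1 (t : R) : 0 <= smoothstep t <= 1.
Proof.
rewrite /smoothstep {1 3}/ramp2 subr_ge0 gerBl sqr_ge0 andbT.
have r0 : 0 <= ramp2 t by exact: sqr_ge0.
rewrite expr_le1 // ?le_max ?lexx// ge_max ler01 /=.
by rewrite gerBl.
Qed.

Variable m : nat.

(** Nonpositive, hence mapped to 0 by [smoothstep], for [s < 1 / (m + 1)]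
    because of the first factor and for [s >= 3] because of the second.  The
    summand 2 keeps the second factor away from 0 at [s = 1], so that the limit
    in [m] is the indicator function of [0 < s <= 1] also at [s = 1], as the
    cone over the sphere requires. *)
Definition shell (s : R) : R := (m.+1%:R * s - 1) * (m.+1%:R * (1 - s) + 2).
Definition dshell (s : R) : R :=
  m.+1%:R * (m.+1%:R * (1 - s) + 2) - (m.+1%:R * s - 1) * m.+1%:R.

Lemma is_derive_shell (s : R) : is_derive s 1 shell (dshell s).
Proof.
have c (a : R) := is_derive_cst a s (1 : R).
have d := is_derive_id s (1 : R).
apply: (is_derive_eq (is_deriveM
  (is_deriveB (is_deriveM (c m.+1%:R) d) (c 1))
  (is_deriveD (is_deriveM (c m.+1%:R) (is_deriveB (c 1) d)) (c 2)))).
rewrite /dshell /GRing.scale /=.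
change ((m.+1%:R * s - 1) * (m.+1%:R * (0 - 1) + (1 - s) * 0 + 0) +
  (m.+1%:R * (1 - s) + 2) * (m.+1%:R * 1 + s * 0 - 0) =
  m.+1%:R * (m.+1%:R * (1 - s) + 2) - (m.+1%:R * s - 1) * m.+1%:R).
ring.
Qed.

Lemma continuous_dshell : continuous dshell.
Proof.
move=> s.
have c (a : R) : {for s, continuous (fun _ : R => a)} by exact: cst_continuous.
have d : {for s, continuous (fun s : R => s)} by exact: cvg_id.
exact: (continuousB
  (continuousM (c m.+1%:R) (continuousD (continuousM (c m.+1%:R) (continuousB (c 1) d)) (c 2)))
  (continuousM (continuousB (continuousM (c m.+1%:R) d) (c 1)) (c m.+1%:R))).
Qed.

Lemma shell_small s : s < m.+1%:R^-1 -> shell s <= 0.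
Proof.
move=> sm; have m0 : 0 < m.+1%:R :> R by rewrite ltr0n.
have s1 : s <= 1 by rewrite (le_trans (ltW sm))// invf_le1// ler1n.
rewrite /shell mulr_le0_ge0//.
  by rewrite subr_le0 mulrC -ler_pdivlMr// mul1r ltW.
by rewrite addr_ge0// mulr_ge0// subr_ge0.
Qed.

Lemma shell_large s : 3 <= s -> shell s <= 0.
Proof.
move=> s3; have m1 : 1 <= m.+1%:R :> R by rewrite ler1n.
rewrite /shell mulr_ge0_le0//; nra.
Qed.

(** The weight [1 / sqrt s], with [s = |y|^2], compensates the factor [|y|] by
    which [|y|^2 D_i G - n y_i G] exceeds a function homogeneous of degree 0. *)
Definition cutoff (s : R) : R := smoothstep (shell s) * (Num.sqrt s)^-1.
Definition dcutoff (s : R) : R :=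
  dsmoothstep (shell s) * dshell s * (Num.sqrt s)^-1 -
  smoothstep (shell s) * (Num.sqrt s ^- 2 * (2 * Num.sqrt s)^-1).

Lemma is_derive_cutoff (s : R) : 0 < s -> is_derive s 1 cutoff (dcutoff s).
Proof.
move=> s0; have sq0 : Num.sqrt s != 0 by rewrite gt_eqF// sqrtr_gt0.
have d1 := @is_derive1_comp R smoothstep shell s _ _ (is_derive_smoothstep _) (is_derive_shell s).
have d2 := is_deriveV sq0 (is_derive1_sqrt s0).
apply: (is_derive_eq (is_deriveM d1 d2)).
rewrite /dcutoff /GRing.scale /=; ring.
Qed.

Lemma continuous_dcutoff (s : R) : 0 < s -> {for s, continuous dcutoff}.
Proof.
move=> s0; have sq0 : Num.sqrt s != 0 by rewrite gt_eqF// sqrtr_gt0.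
have c (a : R) : {for s, continuous (fun _ : R => a)} by exact: cst_continuous.
have csh : {for s, continuous shell}.
  by apply/differentiable_continuous/derivable1_diffP; have [] := is_derive_shell s.
have cst1 : {for s, continuous (smoothstep \o shell)}.
  apply: continuous_comp => //.
  by apply/differentiable_continuous/derivable1_diffP; have [] := is_derive_smoothstep (shell s).
have cst2 : {for s, continuous (dsmoothstep \o shell)}.
  by apply: continuous_comp => //; exact: continuous_dsmoothstep.
have cs : {for s, continuous (@Num.sqrt R)} by exact: sqrt_continuous.
have cV : {for s, continuous (fun s : R => (Num.sqrt s)^-1)} by exact: (cvgV sq0 cs).
have cV2 : {for s, continuous (fun s : R => (Num.sqrt s ^+ 2)^-1)}.
  apply: (@cvgV _ _ _ _ (fun s : R => Num.sqrt s * Num.sqrt s)); first by rewrite sqrf_eq0.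
  exact: (continuousM cs cs).
have cV3 : {for s, continuous (fun s : R => (2 * Num.sqrt s)^-1)}.
  apply: (@cvgV _ _ _ _ (fun s : R => 2 * Num.sqrt s)); first by rewrite mulf_neq0.
  exact: (continuousM (c 2) cs).
exact: (continuousB (continuousM (continuousM cst2 (@continuous_dshell s)) cV)
  (continuousM cst1 (continuousM cV2 cV3))).
Qed.

Lemma cutoff_small s : s < m.+1%:R^-1 -> cutoff s = 0.
Proof. by move=> sm; rewrite /cutoff smoothstep_le0 ?mul0r// shell_small. Qed.

Lemma cutoff_large s : 3 <= s -> cutoff s = 0.
Proof. by move=> s3; rewrite /cutoff smoothstep_le0 ?mul0r// shell_large. Qed.

End cutoff.

Lemma cvg_smoothstep_shell (R : realType) (s : R) : 0 < s ->
  smoothstep (shell m s) @[m --> \oo] --> ((s <= 1)%R%:R : R).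
Proof.
move=> s0; apply: cvg_near_cst; have [s1|s1] := leP s 1.
- near=> m; apply: smoothstep_ge1.
  have m0 : 3 / s <= m.+1%:R.
    rewrite (@le_trans _ _ m%:R)// ?ler_nat//; near: m; exact: nbhs_infty_ger.
  have ms : 3 <= m.+1%:R * s by rewrite -ler_pdivrMr.
  have ms' : 0 <= m.+1%:R * (1 - s) by rewrite mulr_ge0// subr_ge0.
  by rewrite /shell -[1]mulr1 ler_pM//; lra.
- near=> m; apply: smoothstep_le0.
  have m0 : 2 / (s - 1) <= m.+1%:R.
    rewrite (@le_trans _ _ m%:R)// ?ler_nat//; near: m; exact: nbhs_infty_ger.
  have ms : 2 <= m.+1%:R * (s - 1) by rewrite -ler_pdivrMr ?subr_gt0.
  have m1 : 1 <= m.+1%:R :> R by rewrite ler1n.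
  by rewrite /shell mulr_ge0_le0//; lra.
Unshelve. all: by end_near. Qed.

(** * The divergence theorem on the sphere *)

Section divergence.
Variables (R : realType) (n : nat).
Local Notation V := 'rV[R]_n.+1.
Local Notation e_ j := (delta_mx ord0 j : V).

Lemma sphere_continuous_coord i : sphere_continuous (fun x : V => x ord0 i).
Proof.
move=> y y0; apply: (@continuous_comp _ _ _ (@unit_vec R n.+1) (fun z : V => z ord0 i)).
  exact: continuous_unit_vec.
exact: continuous_coord_rV.
Qed.

Lemma sphere_continuousM (k l : V -> R) : sphere_continuous k ->
  sphere_continuous l -> sphere_continuous (fun x => k x * l x).
Proof. by move=> ck cl y y0; exact: (continuousM (ck y y0) (cl y y0)). Qed.

Lemma sphere_continuousD (k l : V -> R) : sphere_continuous k ->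
  sphere_continuous l -> sphere_continuous (fun x => k x + l x).
Proof. by move=> ck cl y y0; exact: (continuousD (ck y y0) (cl y y0)). Qed.

Lemma sphere_continuousB (k l : V -> R) : sphere_continuous k ->
  sphere_continuous l -> sphere_continuous (fun x => k x - l x).
Proof. by move=> ck cl y y0; exact: (continuousB (ck y y0) (cl y y0)). Qed.

Lemma sphere_continuous_cst (a : R) : sphere_continuous (fun _ : V => a).
Proof. by move=> y _; exact: cst_continuous. Qed.

(** The integral over the ball is the limit of integrals of divergences of
    compactly supported fields, all of which vanish.  Dominated convergence
    applies because the integrands are bounded by a bound of [k] on the sphere
    and are supported in the box of half-width 3. *)
Lemma sphere_divergence (g : V -> R) i : C1_sphere g ->
  sint (fun x => sgrad g x ord0 i - n%:R * x ord0 i * g x) = 0.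
Proof.
move=> hg; set k := fun x : V => _.
have ck : sphere_continuous k.
  apply: sphere_continuousB; first exact: sgrad_sphere_continuous.
  apply: sphere_continuousM; last exact: C1_sphere_continuous.
  apply: sphere_continuousM; first exact: sphere_continuous_cst.
  exact: sphere_continuous_coord.
apply: sint_eq0 => //.
have [C kC] := sphere_continuous_bounded ck.
pose T y := sqn y * 'D_(e_ i) (radial_ext g) y - n%:R * y ord0 i * radial_ext g y.
have kT y : y != 0 -> k (unit_vec y) = (Num.sqrt (sqn y))^-1 * T y.
  move=> y0; rewrite /k sgrad_unit_vec// -enormE /T -sqr_enorm /unit_vec !mxE -/(unit_vec y).
  have : enorm y != 0 by rewrite gt_eqF// enorm_gt0.
  by move=> r0; rewrite /radial_ext; field.
have H m : (lebesgue_rV R n.+1).-integrable setT (fun y : V => (cutoff m (sqn y) * T y)%:E) /\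
    (\int[lebesgue_rV R n.+1]_y (cutoff m (sqn y) * T y)%:E = 0)%E.
  apply: (integral_tangential _ _ _ _ (e := m.+1%:R^-1) (L := 3) _ _
     (@is_derive_cutoff R m) (@continuous_dcutoff R m) (@cutoff_small R m) (@cutoff_large R m)).
  - by move=> x j x0; have [] := hg x j x0.
  - by move=> x j x0; have [] := hg x j x0.
  - exact: C1_sphere_continuous.
  - exact: C1_euler.
  - by rewrite invr_gt0.
  - by rewrite ler1n.
pose F m y := (cutoff m (sqn y) * T y)%:E.
pose f := (fun y => (k (unit_vec y))%:E) \_ (@punctured_ball R n).
have Fk m y : y != 0 -> F m y = (smoothstep (shell m (sqn y)) * k (unit_vec y))%:E.
  by move=> y0; rewrite /F /cutoff kT// mulrA.
have F0 m : F m 0 = 0%E.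
  rewrite /F cutoff_small ?mul0r// (_ : sqn 0 = 0) ?invr_gt0//.
  by rewrite /sqn big1// => j _; rewrite mxE expr0n.
have mB : measurable (@punctured_ball R n) by exact: measurable_punctured_ball.
have mf : measurable_fun setT f.
  apply/(measurable_restrictT _ mB); apply/measurable_EFinP.
  apply: (@measurable_funS _ _ _ _ [set y : V | y != 0]).
  - by apply: open_measurable_rV; exact: open_neq0.
  - by move=> y [].
  - by apply: continuous_measurable_rV; [exact: open_neq0|exact: ck].
have Ff y : F m y @[m --> \oo] --> f y.
  have [->|y0] := eqVneq y 0.
    rewrite /f patchE memNset => [|[]/=]; last by rewrite eqxx.
    by apply: cvg_near_cst; apply: nearW => m; rewrite F0.
  have sy : (sqn y <= 1) = (enorm y <= 1).
    by rewrite -sqr_enorm -[X in _ <= X](expr1n _ 2) ler_pXn2r// ?nnegrE ?enorm_ge0.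
  have -> : f y = ((sqn y <= 1)%R%:R * k (unit_vec y))%:E.
    rewrite /f patchE sy; case: ifPn.
      by rewrite inE => -[] /= ->; rewrite mul1r.
    move=> /negP yB; have /negbTE -> : ~~ (enorm y <= 1).
      by apply/negP => y1; apply: yB; rewrite inE.
    by rewrite mul0r.
  under eq_cvg do rewrite Fk//.
  apply: cvg_EFin; first by apply: nearW.
  apply: cvgM; last exact: cvg_cst.
  by apply: cvg_smoothstep_shell; rewrite sqn_gt0.
pose box := [set y : V | forall i, - 3 <= y ord0 i <= 3].
pose g0 y := (`|C| + 1) * \1_box y.
have mbox : measurable box by exact: measurable_box.
have ig0 : (lebesgue_rV R n.+1).-integrable setT (EFin \o g0).
  apply: (@bounded_box_integrable _ _ _ 3 (`|C| + 1)).
  - by apply: measurable_funM => //; exact: measurable_indic.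
  - move=> y; rewrite /g0 normrM ger0_norm ?addr_ge0// indicE.
    by case: (_ \in _); rewrite ?normr1 ?normr0 ?mulr1 ?mulr0 ?addr_ge0.
  - by move=> y yb; rewrite /g0 indicE memNset// mulr0.
have Fg m y : (`|F m y| <= (EFin \o g0) y)%E.
  have g00 : 0 <= g0 y by rewrite mulr_ge0 ?addr_ge0// indicE.
  have [->|y0] := eqVneq y 0; first by rewrite F0 abse0 lee_fin /g0 mulr_ge0 ?addr_ge0.
  have [s3|s3] := leP 3 (sqn y).
    by rewrite /F cutoff_large// mul0r abse0 lee_fin.
  rewrite Fk//= lee_fin /g0 indicE mem_set ?mulr1 => [|j /=].
    have /andP[st0 st1] := smoothstep_ge0_le1 (shell m (sqn y)).
    rewrite normrM ger0_norm// -[leRHS]mul1r ler_pM//.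
    rewrite (le_trans (kC _ (sphere_unit_vec y0)))// (le_trans (ler_norm _))//.
    by rewrite lerDl.
  rewrite -ler_norml -(@ler_pXn2r _ 2)// ?nnegrE// real_normK ?num_real//.
  apply: (@le_trans _ _ (sqn y)); last by rewrite (le_trans (ltW s3))//; lra.
  by rewrite /sqn (bigD1 j)//= lerDl sumr_ge0// => l _; exact: sqr_ge0.
have [_ _ cF] := @dominated_convergence _ _ _ (lebesgue_rV R n.+1) setT measurableT
  F f (EFin \o g0) (fun m => measurable_int _ (H m).1) mf
  (aeW _ (fun y _ => Ff y)) ig0 (aeW _ (fun y m _ => Fg m y)).
rewrite integral_mkcond -/f.
have I0 : [sequence (\int[lebesgue_rV R n.+1]_y F m y)%E]_m = (fun=> 0%E).
  by apply/funext => m; exact: (H m).2.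
rewrite I0 in cF.
exact: (cvg_unique (@ereal_hausdorff R) cF (cvg_cst 0%E)).
Qed.

End divergence.

(** * Calculus of integrals and gradients on the sphere *)

Section sint_linear.
Variables (R : realType) (n : nat).
Local Notation V := 'rV[R]_n.+1.
Local Notation e_ j := (delta_mx ord0 j : V).

Lemma sphere_continuous_sum m (k : 'I_m -> V -> R) :
  (forall i, sphere_continuous (k i)) -> sphere_continuous (fun x => \sum_i k i x).
Proof.
elim: m k => [|m IH] k ck.
  under eq_fun do rewrite big_ord0.
  exact: sphere_continuous_cst.
under eq_fun do rewrite big_ord_recr /=.
by apply: sphere_continuousD => //; apply: IH => i; exact: ck.
Qed.

Lemma sphere_continuous_comp (h : R -> R) (k : V -> R) : continuous h ->
  sphere_continuous k -> sphere_continuous (fun x => h (k x)).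
Proof. by move=> ch ck y y0; exact: (continuous_comp (ck y y0) (ch _)). Qed.

Lemma sintD (k l : V -> R) : sphere_continuous k -> sphere_continuous l ->
  sint (fun x => k x + l x) = sint k + sint l.
Proof.
move=> ck cl; apply: RintegralD; first exact: measurable_sphere.
  exact: sphere_continuous_integrable.
exact: sphere_continuous_integrable.
Qed.

Lemma sintZ (a : R) (k : V -> R) : sphere_continuous k ->
  sint (fun x => a * k x) = a * sint k.
Proof.
move=> ck; apply: RintegralZl; first exact: measurable_sphere.
exact: sphere_continuous_integrable.
Qed.

Lemma sint_sum m (k : 'I_m -> V -> R) : (forall i, sphere_continuous (k i)) ->
  sint (fun x => \sum_i k i x) = \sum_i sint (k i).
Proof.
elim: m k => [|m IH] k ck.
  rewrite big_ord0; under [X in sint X]eq_fun do rewrite big_ord0.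
  by rewrite -[RHS](mul0r (sint (fun _ : V => 0))) -sintZ ?mul0r//; exact: sphere_continuous_cst.
rewrite big_ord_recr /= -IH => [|i]; last exact: ck.
under [X in sint X]eq_fun do rewrite big_ord_recr /=.
by rewrite sintD//; apply: sphere_continuous_sum => i; exact: ck.
Qed.

Lemma sint_ge0 (k : V -> R) : (forall x, sphere R n x -> 0 <= k x) -> 0 <= sint k.
Proof. by move=> k0; apply: Rintegral_ge0. Qed.

Lemma eq_sint (k l : V -> R) : (forall x, sphere R n x -> k x = l x) -> sint k = sint l.
Proof. by move=> kl; apply: eq_Rintegral => x; rewrite inE; exact: kl. Qed.

Lemma C1_sphereM (k l : V -> R) : C1_sphere k -> C1_sphere l ->
  C1_sphere (fun x => k x * l x) /\
  forall x i, x != 0 -> sgrad (fun x => k x * l x) x ord0 i =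
    radial_ext k x * sgrad l x ord0 i + radial_ext l x * sgrad k x ord0 i.
Proof.
move=> hk hl.
have dM x i : x != 0 -> is_derive x (e_ i) (radial_ext (fun x => k x * l x))
   (radial_ext k x * 'D_(e_ i) (radial_ext l) x + radial_ext l x * 'D_(e_ i) (radial_ext k) x).
  move=> x0; have [dk _] := hk x i x0; have [dl _] := hl x i x0.
  exact: is_derive_eq (is_deriveM (derivableP dk) (derivableP dl)) _.
split=> [x i x0|x i x0]; last by rewrite !mxE; have [_ ->] := dM x i x0.
split; first by have [] := dM x i x0.
have [_ ck] := hk x i x0; have [_ cl] := hl x i x0.
have ck0 := C1_sphere_continuous hk x0; have cl0 := C1_sphere_continuous hl x0.
have H : {for x, continuous (fun y =>
   radial_ext k y * 'D_(e_ i) (radial_ext l) y + radial_ext l y * 'D_(e_ i) (radial_ext k) y)}.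
  exact: (continuousD (continuousM ck0 cl) (continuousM cl0 ck)).
have E y : y != 0 -> 'D_(e_ i) (radial_ext (fun x => k x * l x)) y =
  radial_ext k y * 'D_(e_ i) (radial_ext l) y + radial_ext l y * 'D_(e_ i) (radial_ext k) y.
  by move=> y0; have [] := dM y i y0.
have N : \forall y \near x,
  radial_ext k y * 'D_(e_ i) (radial_ext l) y + radial_ext l y * 'D_(e_ i) (radial_ext k) y =
  'D_(e_ i) (radial_ext (fun x => k x * l x)) y.
  by apply: filterS (near_neq0 x0) => y y0; rewrite E.
rewrite /prop_for /continuous_at E//.
exact: cvg_trans (near_eq_cvg N) H.
Qed.

Lemma C1_sphereD (k l : V -> R) : C1_sphere k -> C1_sphere l ->
  C1_sphere (fun x => k x + l x) /\
  forall x i, x != 0 -> sgrad (fun x => k x + l x) x ord0 i =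
    sgrad k x ord0 i + sgrad l x ord0 i.
Proof.
move=> hk hl.
have dD x i : x != 0 -> is_derive x (e_ i) (radial_ext (fun x => k x + l x))
   ('D_(e_ i) (radial_ext k) x + 'D_(e_ i) (radial_ext l) x).
  move=> x0; have [dk _] := hk x i x0; have [dl _] := hl x i x0.
  exact: is_derive_eq (is_deriveD (derivableP dk) (derivableP dl)) _.
split=> [x i x0|x i x0]; last by rewrite !mxE; have [_ ->] := dD x i x0.
split; first by have [] := dD x i x0.
have [_ ck] := hk x i x0; have [_ cl] := hl x i x0.
have H := continuousD ck cl.
have E y : y != 0 -> 'D_(e_ i) (radial_ext (fun x => k x + l x)) y =
  'D_(e_ i) (radial_ext k) y + 'D_(e_ i) (radial_ext l) y.
  by move=> y0; have [] := dD y i y0.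
have N : \forall y \near x,
  'D_(e_ i) (radial_ext k) y + 'D_(e_ i) (radial_ext l) y =
  'D_(e_ i) (radial_ext (fun x => k x + l x)) y.
  by apply: filterS (near_neq0 x0) => y y0; rewrite E.
rewrite /prop_for /continuous_at E//.
exact: cvg_trans (near_eq_cvg N) H.
Qed.

End sint_linear.

(** * Quadratic forms behind the inequality *)

(** With [al = D], [be = C], [ga = - A] the form equals
    [A (A B - D^2 - C^2)], which settles the case [A > 0].  If [A = 0], a small
    negative [ga] makes the linear term dominate unless [D = C = 0]. *)
Lemma quadratic_bound (R : realFieldType) (A B D C : R) : 0 <= A -> 0 <= B ->
  (forall al be ga : R, 0 <= ga ^+ 2 * B + 2 * ga * (al * D + be * C) + (al ^+ 2 + be ^+ 2) * A) ->
  D ^+ 2 + C ^+ 2 <= A * B.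
Proof.
move=> A0 B0 H; set Q := D ^+ 2 + C ^+ 2.
have Q0 : 0 <= Q by rewrite addr_ge0 ?sqr_ge0.
have HQ ga : 0 <= ga ^+ 2 * B + 2 * ga * Q + Q * A.
  by have := H D C ga; rewrite -!expr2.
move: A0; rewrite le_eqVlt => /predU1P[A0|A0].
  rewrite -A0 mul0r leNgt; apply/negP => Qgt0.
  have B1 : 0 < B + 1 by rewrite ltr_wpDl.
  have := HQ (- (Q / (B + 1))); rewrite -A0 mulr0 addr0.
  have -> : (- (Q / (B + 1))) ^+ 2 * B + 2 * - (Q / (B + 1)) * Q =
     - ((Q / (B + 1)) ^+ 2 * (B + 2)) by field; rewrite gt_eqF.
  rewrite oppr_ge0 leNgt mulr_gt0//; first by rewrite exprn_gt0// divr_gt0.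
  by rewrite ltr_wpDl.
have := HQ (- A).
have -> : (- A) ^+ 2 * B + 2 * - A * Q + Q * A = A * (A * B - Q) by ring.
by rewrite pmulr_rge0// subr_ge0.
Qed.

(** Let [r = u^2 + v^2].  The squares of [u P + v Q] and [u Q - v P - r A] add
    up to [r] times the squares of [Q - u A] and [P + v A]: this is
    multiplication by [u - i v].  Hence [r] times the right-hand side is a sum
    of squares.  If [r = 0], everything but the first term vanishes. *)
Lemma pointwise_quadratic (R : rcfType) (I : finType) (X P Q A : I -> R) (u v al be ga : R) :
  0 <= ga ^+ 2 * (\sum_j ((Q j - u * A j) ^+ 2 + (P j + v * A j) ^+ 2)) +
    2 * ga * (al * (\sum_j X j * (u * P j + v * Q j)) +
      be * (Num.sqrt (\sum_j X j ^+ 2) *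
            Num.sqrt (\sum_j (u * Q j - v * P j - (u ^+ 2 + v ^+ 2) * A j) ^+ 2))) +
    (al ^+ 2 + be ^+ 2) * (\sum_j X j ^+ 2 * (u ^+ 2 + v ^+ 2)).
Proof.
set r := u ^+ 2 + v ^+ 2.
have r0 : 0 <= r by rewrite addr_ge0 ?sqr_ge0.
set W := \sum_j _.
have W0 : 0 <= W by apply: sumr_ge0 => j _; rewrite addr_ge0 ?sqr_ge0.
set S := \sum_j X j ^+ 2.
have S0 : 0 <= S by apply: sumr_ge0 => j _; rewrite sqr_ge0.
set c2 := \sum_j (_ - _ * _) ^+ 2.
have c20 : 0 <= c2 by apply: sumr_ge0 => j _; rewrite sqr_ge0.
rewrite -mulr_suml -/S.
move: r0; rewrite le_eqVlt => /predU1P[r0|r0].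
  have [u0 v0] : u = 0 /\ v = 0.
    move/eqP: r0; rewrite eq_sym paddr_eq0 ?sqr_ge0// !sqrf_eq0.
    by move=> /andP[/eqP-> /eqP->].
  have c0 : c2 = 0.
    by rewrite /c2 big1// => j _; rewrite -r0 u0 v0 !mul0r !subr0 expr0n.
  rewrite c0 -r0 sqrtr0 mulr0 mulr0 big1 => [|j _]; last by rewrite u0 v0 !mul0r addr0 mulr0.
  by rewrite !mulr0 !addr0 mulr0 addr0 mulr_ge0// sqr_ge0.
set D := \sum_j X j * _.
have rW : r * W = \sum_j (u * P j + v * Q j) ^+ 2 + c2.
  rewrite /W /c2 mulr_sumr -big_split /=; apply: eq_bigr => j _; rewrite /r; ring.
rewrite -(pmulr_rge0 _ r0).
have -> : r * (ga ^+ 2 * W + 2 * ga * (al * D + be * (Num.sqrt S * Num.sqrt c2)) +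
    (al ^+ 2 + be ^+ 2) * (S * r)) =
  \sum_j (ga * (u * P j + v * Q j) + al * r * X j) ^+ 2 +
  (ga * Num.sqrt c2 + be * Num.sqrt S * r) ^+ 2.
  have -> : \sum_j (ga * (u * P j + v * Q j) + al * r * X j) ^+ 2 =
     ga ^+ 2 * \sum_j (u * P j + v * Q j) ^+ 2 + 2 * ga * al * r * D + al ^+ 2 * r ^+ 2 * S.
    rewrite /D /S !mulr_sumr -!big_split /=; apply: eq_bigr => j _; ring.
  have -> : (ga * Num.sqrt c2 + be * Num.sqrt S * r) ^+ 2 =
    ga ^+ 2 * c2 + 2 * ga * be * r * (Num.sqrt S * Num.sqrt c2) + be ^+ 2 * r ^+ 2 * S.
    rewrite -{2}(sqr_sqrtr c20) -{3}(sqr_sqrtr S0); ring.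
  have -> : ga ^+ 2 * c2 = ga ^+ 2 * (r * W - \sum_j (u * P j + v * Q j) ^+ 2).
    by rewrite rW addrC addKr.
  ring.
by rewrite addr_ge0 ?sqr_ge0// sumr_ge0// => j _; exact: sqr_ge0.
Qed.

(** * The uncertainty inequality *)

Lemma sqr_normc (R : rcfType) (z : R[i]) :
  normc z ^+ 2 = complex.Re z ^+ 2 + complex.Im z ^+ 2.
Proof. by case: z => a b /=; rewrite sqr_sqrtr// addr_ge0 ?sqr_ge0. Qed.

Section assembly.
Variables (R : realType) (n : nat) (f : 'rV[R]_n.+1 -> R[i]).
Hypothesis hf : C1_sphereC f.
Local Notation V := 'rV[R]_n.+1.

Let u (x : V) := complex.Re (f x).
Let v (x : V) := complex.Im (f x).
Let P j (x : V) := sgrad u x ord0 j.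
Let Q j (x : V) := sgrad v x ord0 j.
Let X j (x : V) := x ord0 j - tau f ord0 j.
Let hu : C1_sphere u. Proof. by case: hf. Qed.
Let hv : C1_sphere v. Proof. by case: hf. Qed.
Let rho (x : V) := u x ^+ 2 + v x ^+ 2.

Let cu : sphere_continuous u. Proof. exact: C1_sphere_continuous. Qed.
Let cv : sphere_continuous v. Proof. exact: C1_sphere_continuous. Qed.
Let cP j : sphere_continuous (P j). Proof. exact: sgrad_sphere_continuous. Qed.
Let cQ j : sphere_continuous (Q j). Proof. exact: sgrad_sphere_continuous. Qed.
Let cX j : sphere_continuous (X j).
Proof.
apply: sphere_continuousB; first exact: sphere_continuous_coord.
exact: sphere_continuous_cst.
Qed.
Let cst_c (a : R) : sphere_continuous (fun _ : V => a).
Proof. exact: sphere_continuous_cst. Qed.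
Let cX2 (k : V -> R) : sphere_continuous k -> sphere_continuous (fun x => k x ^+ 2).
Proof. by move=> ck; exact: sphere_continuousM. Qed.
Let crho : sphere_continuous rho.
Proof. by apply: sphere_continuousD; exact: cX2. Qed.

Lemma VxE : Vx f = sint (fun x => \sum_j X j x ^+ 2 * rho x).
Proof.
apply: eq_sint => x _; rewrite sqr_enorm sqr_normc mulr_suml.
by apply: eq_bigr => j _; congr (_ ^+ 2 * _); rewrite mxE [X in _ + X = _]mxE.
Qed.

Lemma Vgrad_starE : Vgrad_star f =
  sint (fun x => \sum_j ((Q j x - u x * astar f ord0 j) ^+ 2 +
                         (P j x + v x * astar f ord0 j) ^+ 2)).
Proof.
apply: eq_sint => x _.
rewrite /hnorm sqr_sqrtr; last by apply: sumr_ge0 => j _; exact: sqr_ge0.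
apply: eq_bigr => j _; rewrite sqr_normc.
have -> : ((- 'i%C) *: sgradC f x - f x *: rowC (astar f)) ord0 j =
  ((Q j x - u x * astar f ord0 j) +i* (- (P j x + v x * astar f ord0 j)))%C.
  have E1 : ((- 'i%C) *: sgradC f x) ord0 j = (- 'i%C) * (P j x +i* Q j x)%C.
    by rewrite [LHS]mxE; congr (_ * _); rewrite [LHS]mxE.
  have E2 : (f x *: rowC (astar f)) ord0 j = f x * (astar f ord0 j)%:C%C.
    by rewrite [LHS]mxE; congr (_ * _); rewrite [LHS]mxE.
  rewrite [LHS]mxE E1 [X in _ + X = _]mxE E2.
  rewrite /u /v; case: (f x) => a b.
  by apply/eqP; rewrite eq_complex /=; apply/andP; split; apply/eqP; ring.
by rewrite /= sqrrN.
Qed.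

(** Where [f] vanishes both sides do, since then [u = v = 0]; elsewhere the
    factor [rho] clears the denominator of the phase derivative. *)
Lemma COV_starE : COV_star f =
  sint (fun x => Num.sqrt (\sum_j X j x ^+ 2) *
    Num.sqrt (\sum_j (u x * Q j x - v x * P j x - rho x * astar f ord0 j) ^+ 2)).
Proof.
apply: eq_sint => x _; rewrite -mulrA; congr (_ * _).
  rewrite enormE; congr Num.sqrt; apply: eq_bigr => j _; congr (_ ^+ 2).
  by rewrite mxE [X in _ + X = _]mxE.
rewrite sqr_normc -/(u x) -/(v x) -/(rho x).
have r0 : 0 <= rho x by rewrite addr_ge0 ?sqr_ge0.
rewrite mulrC -[X in X * _](ger0_norm r0) -enormZ enormE; congr Num.sqrt.
apply: eq_bigr => j _; congr (_ ^+ 2).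
have E1 : phase_deriv f x ord0 j = (rho x)^-1 * (u x * Q j x - v x * P j x).
  rewrite /phase_deriv sqr_normc -/(u x) -/(v x) -/(rho x) [LHS]mxE.
  congr (_ * _); rewrite [LHS]mxE; congr (_ + _); first by rewrite [LHS]mxE.
  by rewrite [LHS]mxE; congr (- _); rewrite [LHS]mxE.
have -> : (rho x *: (phase_deriv f x - astar f)) ord0 j =
    rho x * (phase_deriv f x ord0 j - astar f ord0 j).
  by rewrite [LHS]mxE; congr (_ * _); rewrite [LHS]mxE; congr (_ + _); rewrite [LHS]mxE.
rewrite E1.
rewrite mulrBr; congr (_ - _).
have [r00|rn0] := eqVneq (rho x) 0; last by rewrite mulrA mulfV ?mul1r.
have [u0 v0] : u x = 0 /\ v x = 0.
  move/eqP: r00; rewrite paddr_eq0 ?sqr_ge0// !sqrf_eq0.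
  by move=> /andP[/eqP-> /eqP->].
by rewrite u0 v0 r00 !mul0r subr0.
Qed.

Lemma sgrad_rho : C1_sphere rho /\ forall x j, sphere R n x ->
  sgrad rho x ord0 j = 2 * (u x * P j x + v x * Q j x).
Proof.
have [hu2 gu2] := C1_sphereM hu hu; have [hv2 gv2] := C1_sphereM hv hv.
have [hr gr] := C1_sphereD hu2 hv2.
split; first exact: hr.
move=> x j xS; have x0 := sphere_neq0 xS.
rewrite [LHS]gr// gu2// gv2// /radial_ext (unit_vec_sphere xS) -/(P j x) -/(Q j x); ring.
Qed.

Lemma tauE j : tau f ord0 j = sint (fun x => x ord0 j * rho x).
Proof. by rewrite mxE; apply: eq_sint => x _; rewrite sqr_normc. Qed.

Lemma sint_sgrad_rho j : sint (fun x => sgrad rho x ord0 j) = n%:R * tau f ord0 j.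
Proof.
have [hr _] := sgrad_rho.
have c1 : sphere_continuous (fun x : V => x ord0 j * rho x).
  by apply: sphere_continuousM => //; exact: sphere_continuous_coord.
have := sphere_divergence j hr.
rewrite (eq_sint (l := fun x => sgrad rho x ord0 j + (- n%:R) * (x ord0 j * rho x))); last first.
  by move=> x _; rewrite mulNr mulrA.
rewrite sintD; [|exact: sgrad_sphere_continuous|exact: sphere_continuousM].
by rewrite sintZ// mulNr -tauE => /eqP; rewrite subr_eq0 => /eqP.
Qed.

(** The integrand is half the scalar product of [x - tau f] with the gradient of
    [rho]; the gradient is orthogonal to [x], and its integral is given by the
    divergence theorem. *)
Lemma sint_radial : sint (fun x => \sum_j X j x * (u x * P j x + v x * Q j x)) =
  - (n%:R / 2 * sqn (tau f)).
Proof.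
have [hr gr] := sgrad_rho.
rewrite (eq_sint (l := fun x => \sum_j (- (tau f ord0 j / 2)) * sgrad rho x ord0 j)).
  rewrite sint_sum => [|j]; last first.
    by apply: sphere_continuousM => //; exact: sgrad_sphere_continuous.
  rewrite /sqn mulr_sumr -sumrN; apply: eq_bigr => j _.
  rewrite sintZ; last exact: sgrad_sphere_continuous.
  by rewrite sint_sgrad_rho; field.
move=> x xS; have x0 := sphere_neq0 xS.
have eul := C1_euler hr x0.
rewrite -[RHS]addr0 -[X in _ + X](mulr0 2^-1) -[X in _ + _ * X]eul mulr_sumr -big_split /=.
apply: eq_bigr => j _.
have -> : 'D_(delta_mx ord0 j) (radial_ext rho) x = sgrad rho x ord0 j by rewrite mxE.
by rewrite gr// /X; field.
Qed.

Lemma uncertainty_quadratic (al be ga : R) :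
  0 <= ga ^+ 2 * Vgrad_star f +
    2 * ga * (al * - (n%:R / 2 * sqn (tau f)) + be * COV_star f) +
    (al ^+ 2 + be ^+ 2) * Vx f.
Proof.
rewrite -sint_radial COV_starE VxE Vgrad_starE.
set W := fun x : V => _. set D := fun x : V => _. set C := fun x : V => _. set E := fun x : V => _.
have cW : sphere_continuous W.
  apply: sphere_continuous_sum => j; apply: sphere_continuousD; apply: cX2.
    by apply: sphere_continuousB => //; exact: sphere_continuousM.
  by apply: sphere_continuousD => //; exact: sphere_continuousM.
have cD : sphere_continuous D.
  apply: sphere_continuous_sum => j; apply: sphere_continuousM => //.
  by apply: sphere_continuousD; exact: sphere_continuousM.
have cC : sphere_continuous C.
  apply: sphere_continuousM; apply: sphere_continuous_comp (@sqrt_continuous R) _;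
    apply: sphere_continuous_sum => j; apply: cX2 => //.
  apply: sphere_continuousB; last exact: sphere_continuousM.
  by apply: sphere_continuousB; exact: sphere_continuousM.
have cE : sphere_continuous E.
  apply: sphere_continuous_sum => j; apply: sphere_continuousM => //; exact: cX2.
have cZ (a : R) (k : V -> R) : sphere_continuous k -> sphere_continuous (fun x => a * k x).
  by move=> ck; exact: (sphere_continuousM (@cst_c a) ck).
have cDC : sphere_continuous (fun x => al * D x + be * C x).
  by apply: sphere_continuousD; exact: cZ.
have -> : ga ^+ 2 * sint W + 2 * ga * (al * sint D + be * sint C) +
    (al ^+ 2 + be ^+ 2) * sint E =
  sint (fun x => ga ^+ 2 * W x + 2 * ga * (al * D x + be * C x) +
                 (al ^+ 2 + be ^+ 2) * E x).
  rewrite [RHS]sintD; [|by apply: sphere_continuousD; exact: cZ|exact: cZ].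
  rewrite [in RHS]sintD; [|exact: cZ|exact: cZ].
  rewrite sintZ// sintZ// sintZ// sintD; [|exact: cZ|exact: cZ].
  by rewrite sintZ// sintZ.
apply: sint_ge0 => x _.
exact: (pointwise_quadratic (X^~ x) (P^~ x) (Q^~ x) (fun j => astar f ord0 j)
  (u x) (v x) al be ga).
Qed.

End assembly.

Theorem theorem1p12 (R : realType) (n : nat) (hn : (2 <= n)%N)
    (f : 'rV[R]_n.+1 -> R[i])
    (hf : C1_sphereC f)
    (habsf : C1_sphere (fun x => normc (f x)))
    (hnormf : \int[sphere_measure R n]_(x in sphere R n) (normc (f x) ^+ 2) = 1) :
  Vx f * Vgrad_star f >=
    n%:R ^+ 2 / 4 * enorm (tau f) ^+ 4 + COV_star f ^+ 2.
Proof.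
have Vx0 : 0 <= Vx f by apply: sint_ge0 => x _; rewrite mulr_ge0 ?sqr_ge0.
have Vg0 : 0 <= Vgrad_star f by apply: sint_ge0 => x _; rewrite sqr_ge0.
have := quadratic_bound Vx0 Vg0 (uncertainty_quadratic hf).
congr (_ + _ <= _).
by rewrite -sqr_enorm; field.
Qed.
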